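(* Let $I=[0,T]$ be a bounded time interval. Let $\mathcal{B}$ be a separable, reflexive, uniformly smooth Banach space which is ''$I$-smoothly weakly compact'' for an exponent $p\in[2,\infty)$. Let $f:\mathcal{B}\to\mathcal{B}$ be a continuous function admitting at most a linear growth and let $r>0$ be a fixed real. Let $C:t\in I\mapsto C(t)$ be a set-valued map taking nonempty, ball-compact and $r$-prox-regular values in $\mathcal{B}$. Assume that $C(\cdot)$ moves in a Lipschitz way: there exists a constant $k>0$ such that for all $s,t\in I$, $$H(C(t),C(s))\le k|t-s|.$$ Then for all $u_0\in C(0)$, the system $$\dot u(t)+\mathrm{N}(C(t),u(t))\ni f(u(t))\ \text{ for a.e. } t\in I,\qquad u(0)=u_0,$$ has an absolutely continuous solution $u$, and for all $t\in I$, $u(t)\in C(t)$.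
   Context: Banach spaces are real; the norm of $\mathcal{B}$ is $\|\cdot\|$; $B(x,\rho)$ is the open ball of center $x$ and radius $\rho$. Hausdorff distance of nonempty sets: $H(S_1,S_2):=\max\left(\sup_{x\in S_1}d(x,S_2),\ \sup_{x\in S_2}d(x,S_1)\right)$. Projection: for $C\subset\mathcal{B}$ closed and $x\in\mathcal{B}$, $P_C(x):=\{y\in C:\ \|x-y\|=d(x,C)\}$. Proximal normal cone: for $x\in C$, $\mathrm{N}(C,x):=\{v\in\mathcal{B}:\ \exists s>0,\ x\in P_C(x+sv)\}$. Prox-regularity: a closed set $C\subset\mathcal{B}$ is $r$-prox-regular ($r>0$) if for all $x\in C$ and all $v\in\mathrm{N}(C,x)\setminus\{0\}$, $B\left(x+r\frac{v}{\|v\|},r\right)\cap C=\emptyset$. Ball-compact: $C\subset\mathcal{B}$ is ball-compact if for every closed ball $\overline{B}(x,R)$ the set $\overline{B}(x,R)\cap C$ is compact (in particular $C$ is closed). At most linear growth: there exists $L>0$ with $\|f(x)\|\le L(1+\|x\|)$ for all $x\in\mathcal{B}$. Uniformly smooth: a Banach space $E$ is uniformly smooth if $\lim_{t\to0}\frac{\|x_0+th\|_E-\|x_0\|_E}{t}$ exists uniformly with respect to unit vectors $x_0,h$. For uniformly smooth $E$ and $p\in(1,\infty)$, $x\mapsto\|x\|_E^p$ is $C^1$ on $E$ and $J_p(x):=\frac1p(\nabla\|\cdot\|_E^p)(x)\in E^*$. $I$-smoothly weakly compact: a separable reflexive uniformly smooth Banach space $E$ is $I$-smoothly weakly compact for an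 exponent $p\in(1,\infty)$ if from every bounded sequence $(x_n)_{n\ge0}$ of $L^\infty(I,E)$ one can extract a subsequence $(y_n)_{n\ge0}$ converging weakly to some $y\in L^\infty(I,E)$ (weak convergence in $L^\infty(I,E)=[L^1(I,E^* )]^*$, i.e. tested against $L^1(I,E^* )$) such that for all $z\in L^\infty(I,E)$ and $\phi\in L^1(I,\mathbb{R})$, $$\lim_{n\to\infty}\int_I\langle J_p(z(t)+y_n(t))-J_p(y_n(t)),y_n(t)\rangle\,\phi(t)\,dt=\int_I\langle J_p(z(t)+y(t))-J_p(y(t)),y(t)\rangle\,\phi(t)\,dt,$$ where $\langle\cdot,\cdot\rangle$ is the $E^*$–$E$ duality pairing. *)

(* Defs.v *)
From HB Require Import structures.
From mathcomp Require Import all_boot all_order all_algebra.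
From mathcomp Require Import all_classical all_reals all_analysis.

Set Implicit Arguments.
Unset Strict Implicit.
Unset Printing Implicit Defensive.

Import Order.TTheory GRing.Theory Num.Theory.
Import numFieldNormedType.Exports.

Local Open Scope classical_set_scope.
Local Open Scope ring_scope.

Section Dual.
Context {R : realType} {E : normedModType R}.

Definition dual_pred : {pred (E -> R^o)} :=
  [pred f : E -> R^o | `[< linear f /\ continuous f >]].

Record dual := Dual {dual_fun :> E -> R^o ; _ : dual_fun \in dual_pred}.

HB.instance Definition _ := [isSub for dual_fun].
HB.instance Definition _ := [Choice of dual by <:].

Lemma dual_submod_closed : submod_closed dual_pred.
Proof.
split.
  apply/asboolP; split; last exact: cst_continuous.
  by move=> a x y; rewrite /= scaler0 addr0.
move=> a f g /asboolP[lf cf] /asboolP[lg cg].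
apply/asboolP; split.
  move=> b x y; rewrite !fctE lf lg !scalerDr !scalerA (mulrC a b) -!addrA.
  by congr (_ + _); rewrite addrCA.
move=> x; apply: (@continuousD R R^o E (a *: f) g); last exact: cg.
exact: (@continuousZl_tmp R R^o E f a x (cf x)).
Qed.

HB.instance Definition _ :=
  GRing.isSubmodClosed.Build R (E -> R^o) dual_pred dual_submod_closed.
HB.instance Definition _ := [SubChoice_isSubLmodule of dual by <:].

Implicit Types phi psi : dual.

Lemma dual_linear phi : linear phi.
Proof. by case: phi => f /= /asboolP[]. Qed.

Lemma dual_continuous phi : continuous phi.
Proof. by case: phi => f /= /asboolP[]. Qed.

HB.instance Definition _ phi :=
  GRing.isLinear.Build R E R^o *:%R phi (@dual_linear phi).

Definition dual_norm phi : R := sup [set `|phi x| | x in [set x : E | `|x| <= 1]].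

Let unit_image phi := [set `|phi x| | x in [set x : E | `|x| <= 1]].

Let unit_image0 phi : unit_image phi 0.
Proof. by exists 0; rewrite /= ?normr0// linear0 normr0. Qed.

Let unit_image_sup phi : has_sup (unit_image phi).
Proof.
split; first by exists 0; exact: unit_image0.
have /linear_boundedP/pinfty_ex_gt0[M M0 fM] :=
  continuous_linear_bounded (0 : E) (@dual_continuous phi (0 : E)).
exists M => _ [x /= x1 <-]; rewrite (le_trans (fM x))//.
by rewrite ler_piMr// ltW.
Qed.

Lemma dual_norm_ge phi (x : E) : `|x| <= 1 -> `|phi x| <= dual_norm phi.
Proof.
by move=> x1; apply: ub_le_sup; [exact: (unit_image_sup phi).2|exists x].
Qed.

Lemma dual_norm_le phi (M : R) :
  (forall x : E, `|x| <= 1 -> `|phi x| <= M) -> dual_norm phi <= M.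
Proof.
move=> fM; apply: ge_sup; first by exists 0; exact: unit_image0.
by move=> _ [x /= x1 <-]; exact: fM.
Qed.

Lemma dual_norm_ge0 phi : 0 <= dual_norm phi.
Proof. by rewrite (le_trans _ (@dual_norm_ge phi 0 _))// normr0. Qed.

Lemma dual_normP phi (x : E) : `|phi x| <= dual_norm phi * `|x|.
Proof.
have [->|x0] := eqVneq x 0; first by rewrite linear0 !normr0 mulr0.
have xV : `| `|x|^-1 *: x| <= 1.
  by rewrite normrZ normfV normr_id mulVf// normr_eq0.
have := dual_norm_ge phi xV; rewrite linearZ/= [X in X <= _]normrM.
by rewrite normfV normr_id mulrC ler_pdivrMr// normr_gt0.
Qed.

Lemma dual_ler_normD phi psi : dual_norm (phi + psi) <= dual_norm phi + dual_norm psi.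
Proof.
apply: dual_norm_le => x x1; rewrite (le_trans (ler_normD _ _))//.
by rewrite lerD// dual_norm_ge.
Qed.

Lemma dual_normrZ (a : R) phi : dual_norm (a *: phi) = `|a| * dual_norm phi.
Proof.
have le (b : R) psi : dual_norm (b *: psi) <= `|b| * dual_norm psi.
  apply: dual_norm_le => x x1.
  by rewrite [X in X <= _]normrM ler_wpM2l// dual_norm_ge.
apply/le_anti; rewrite le/=; have [->|a0] := eqVneq a 0.
  by rewrite normr0 mul0r dual_norm_ge0.
rewrite -ler_pdivlMl ?normr_gt0// -normfV (le_trans _ (le _ _))//.
by rewrite scalerA mulVf// scale1r.
Qed.

Lemma dual_normr0_eq0 phi : dual_norm phi = 0 -> phi = 0.
Proof.
move=> phi0; apply/val_inj/funext => x /=; apply/eqP; rewrite -normr_le0.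
by rewrite (le_trans (dual_normP _ _))// phi0 mul0r.
Qed.

HB.instance Definition _ :=
  Lmodule_isNormed.Build R dual dual_ler_normD dual_normrZ dual_normr0_eq0.

End Dual.
Arguments dual {R} E.

Section BanachSpaces.
Context {R : realType}.
Implicit Type E : normedModType R.

Definition separable E := exists2 D : set E, countable D & dense D.

(* The canonical embedding of [E] into its bidual is onto. *)
Definition reflexive_space E :=
  forall Phi : dual (dual E), exists x : E, forall phi : dual E, Phi phi = phi x.

Definition uniformly_smooth E :=
  exists D : E -> E -> R, forall e : R, 0 < e ->
    \forall t \near (0 : R)^', forall x0 h : E, `|x0| = 1 -> `|h| = 1 ->
      `| (`|x0 + t *: h| - `|x0|) / t - D x0 h | < e.

(* The Frechet derivative, as an element of the dual; [0] (the default point)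
   where [g] is not differentiable. *)
Definition gradient E (g : E -> R^o) (x : E) : dual E :=
  xget 0 [set phi : dual E | is_diff x g phi].

Definition Jp E (p : R) (x : E) : dual E :=
  p^-1 *: gradient (fun y : E => `|y| `^ p : R^o) x.

End BanachSpaces.

Section BochnerSpaces.
Context {R : realType}.
Let mu := @lebesgue_measure R.
Implicit Types (V : normedModType R) (I : set R).

(* Representatives are Borel: the simple functions converge everywhere on [I],
   not merely almost everywhere. Every class of a.e. equal strongly measurable
   functions contains such a representative. *)
Definition strongly_measurable V I (f : R -> V) :=
  exists s : nat -> R -> V,
    (forall n, finite_set (range (s n)) /\
       forall v, measurable (s n @^-1` [set v])) /\
    (forall t, I t -> s n t @[n --> \oo] --> f t).

Definition ess_bounded V I (M : R) (f : R -> V) :=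
  {ae mu, forall t, I t -> `|f t| <= M}.

Definition in_Linfty V I (f : R -> V) :=
  strongly_measurable I f /\ exists M, ess_bounded I M f.

Definition in_L1 V I (f : R -> V) :=
  strongly_measurable I f /\ (\int[mu]_(t in I) (`|f t|%:E) < +oo)%E.

Definition smoothly_weakly_compact I (E : normedModType R) (p : R) :=
  forall x : nat -> R -> E,
    (forall n, strongly_measurable I (x n)) ->
    (exists M, forall n, ess_bounded I M (x n)) ->
  exists sigma : nat -> nat, {homo sigma : m n / (m < n)%N} /\
  exists y : R -> E, in_Linfty I y /\
    (forall g : R -> dual E, in_L1 I g ->
      \int[mu]_(t in I) (g t (x (sigma n) t)) @[n --> \oo] -->
        \int[mu]_(t in I) (g t (y t))) /\
    (forall (z : R -> E) (phi : R -> R),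
      in_Linfty I z -> mu.-integrable I (EFin \o phi) ->
      \int[mu]_(t in I)
        ((Jp p (z t + x (sigma n) t) - Jp p (x (sigma n) t)) (x (sigma n) t)
           * phi t) @[n --> \oo] -->
      \int[mu]_(t in I)
        ((Jp p (z t + y t) - Jp p (y t)) (y t) * phi t)).

End BochnerSpaces.

Section ProxRegular.
Context {R : realType} {E : normedModType R}.
Implicit Types (S : set E) (x v : E).

(* Hence [edist_inf S x] is the distance from [x] to [S]. *)
Lemma edist_norm x y : edist (x, y) = `|x - y|%:E.
Proof.
apply/eqP; rewrite eq_le; apply/andP; split.
  apply/lee_addgt0Pr => e e0; rewrite -EFinD; apply: edist_fin.
    by rewrite ltr_wpDl.
  by rewrite -ball_normE/= ltrDl.
apply: le_ereal_inf_tmp => _ [r [r0 + <-]].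
by rewrite -ball_normE/= lee_fin => /ltW.
Qed.

Definition hausdorff_dist S1 S2 : \bar R :=
  maxe (ereal_sup [set edist_inf S2 x | x in S1])
       (ereal_sup [set edist_inf S1 x | x in S2]).

Definition proj S x : set E :=
  [set y | S y /\ `|x - y|%:E = edist_inf S x].

Definition normal_cone S x : set E :=
  [set v | exists2 s : R, 0 < s & proj S (x + s *: v) x].

Definition prox_regular (r : R) S :=
  closed S /\
  forall x v, S x -> normal_cone S x v -> v != 0 ->
    ball (x + (r / `|v|) *: v) r `&` S = set0.

Definition ball_compact S :=
  forall x (rho : R), compact (closed_ball x rho `&` S).

End ProxRegular.

(* On [[a, b]]; [trivIset] of the open intervals says that the closed ones do
   not overlap. *)
Definition abs_continuous {R : realType} {E : normedModType R}
    (a b : R) (u : R -> E) :=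
  forall e : R, 0 < e -> exists2 d : R, 0 < d &
    forall (n : nat) (s t : 'I_n -> R),
      (forall i, [/\ a <= s i, s i <= t i & t i <= b]) ->
      trivIset [set: 'I_n] (fun i => `]s i, t i[%classic) ->
      \sum_(i < n) (t i - s i) < d ->
      \sum_(i < n) `|u (t i) - u (s i)| < e.

(* Main.v *)
From HB Require Import structures.
Require Import Defs.
From mathcomp Require Import all_boot all_order all_algebra.
From mathcomp Require Import all_classical all_reals all_analysis.
From mathcomp Require Import measurable_realfun ring lra.

Set Implicit Arguments.
Unset Strict Implicit.
Unset Printing Implicit Defensive.

Import Order.TTheory GRing.Theory Num.Theory.
Import numFieldNormedType.Exports.

Local Open Scope classical_set_scope.
Local Open Scope ring_scope.

(** The solution is a limit of the catching-up scheme. Over a time step [h] one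
    follows [f] and projects back onto the moved set: [u (i+1)] is a projection
    of [u i + h f (u i)] on [C ((i+1) h)]. Then
    [v i = (u i + h f (u i) - u (i+1)) / h] is a proximal normal at [u (i+1)], and
    [u (i+1) - u i = h (f (u i) - v i)]. As [C] moves with speed at most [k], the
    normal [v i] is bounded by [k + |f (u i)|], and a discrete Gronwall estimate
    bounds everything independently of [h] (lemma [catching_up_approximation]).

    As [h] goes to [0] there are two modes of convergence. The positions converge
    strongly: ball-compactness of the sets makes them relatively compact at every
    time and they are Lipschitz up to an error of order [h], so a subsequence
    converges uniformly to a Lipschitz curve [U] with values in [C]
    (lemma [uniform_subsequence]). The normals [x n] converge only weakly, to some
    [y]. Two relations have to survive.

    The equation: it passes to the limit when tested against a functional, which
    says that [U] is a weak primitive of [w = f o U - y]. The Lebesgue points of the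
    countably many scalar functions [|w - d j|], with [d] dense, together with a
    norming functional, improve this to strong differentiability almost everywhere
    (lemma [ae_derivable]).

    Normality of [y t] to [C t] at [U t]: prox-regularity says that, for a fixed
    [rho > 0] and up to vanishing errors,
    [|rho x n| <= |U - c + rho x n|] for all [c] in [C t]. This is nonlinear in
    [x n], but with [g = |.|^p], whose derivative is [p J_p], and with
    [w = U - c],
      [g (w + rho x) - g (rho x) - g w
         = p int_0^rho < J_p (w + s x) - J_p (s x), x > ds
         = p int_0^rho s^(p-1) < J_p (w / s + x) - J_p x, x > ds],
    and the last bracket is exactly the quantity that smooth weak compactness
    controls. Convexity of [g] makes the Riemann sums of this integral converge at
    a rate that is uniform on bounded sets (lemma [normp_increment_riemann]), so
    finite sums suffice and the inequality passes to the limit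
    (lemma [weak_limit_proximal]). No measurable selection [c] of [C] is chosen:
    [c] is replaced by constants from a dense sequence, at the price of their
    distance to [C t], which is Lipschitz in [t]. *)

(** * Real powers *)

Section PowerFunction.
Context {R : realType}.
Implicit Types a b p q M : R.

(** The graph of the power lies above its tangents: this is Young's inequality for
    [b] and [a `^ (p - 1)] with the exponents [p] and [p / (p - 1)]. *)
Lemma powR_tangent p a b : 1 <= p -> 0 <= a -> 0 <= b ->
  a `^ p + p * a `^ (p - 1) * (b - a) <= b `^ p.
Proof.
move=> p1 a0 b0; have p0 : 0 < p by exact: lt_le_trans p1.
have E : a * a `^ (p - 1) = a `^ p by rewrite mulr_powRB1.
have [->|pn1] := eqVneq p 1.
  by rewrite subrr powRr0 !powRr1//; lra.
have p1' : 0 < p - 1 by rewrite subr_gt0 lt_neqAle eq_sym pn1.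
pose q := p / (p - 1).
have q0 : 0 < q by rewrite divr_gt0.
have pq : p^-1 + q^-1 = 1.
  by rewrite /q invf_div; field; rewrite gt_eqF.
have := conjugate_powR b0 (powR_ge0 a (p - 1)) p0 q0 pq.
rewrite -powRrM (_ : (p - 1) * q = p); last first.
  by rewrite /q mulrC divfK// gt_eqF.
move=> /(ler_wpM2l (ltW p0)).
have -> : p * (b `^ p / p + a `^ p / q) = b `^ p + (p - 1) * a `^ p.
  by rewrite /q; field; rewrite !gt_eqF.
move: E; set A := a `^ (p - 1); set A' := a `^ p; set B := b `^ p => E.
rewrite -E; lra.
Qed.

Lemma powR_sub_le p a b M : 1 <= p -> 0 <= a -> 0 <= b -> b <= M ->
  b `^ p - a `^ p <= p * M `^ (p - 1) * `|b - a|.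
Proof.
move=> p1 a0 b0 bM.
have M0 : 0 <= M by exact: le_trans bM.
have [ba|ab] := leP b a.
  have : b `^ p <= a `^ p.
    by rewrite ge0_ler_powR// ?nnegrE//; lra.
  move=> H; apply: (@le_trans _ _ 0); first by lra.
  by rewrite !mulr_ge0// ?powR_ge0//; lra.
have := powR_tangent p1 b0 a0 => H.
rewrite gtr0_norm ?subr_gt0//.
have H2 : b `^ (p - 1) <= M `^ (p - 1).
  by rewrite ge0_ler_powR// ?nnegrE//; lra.
apply: (@le_trans _ _ (p * b `^ (p - 1) * (b - a))); first by lra.
by rewrite ler_wpM2r ?subr_ge0 ?(ltW ab)// ler_wpM2l//; lra.
Qed.

Lemma powR_lipschitz p a b M : 1 <= p -> 0 <= a -> 0 <= b -> a <= M -> b <= M ->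
  `|b `^ p - a `^ p| <= p * M `^ (p - 1) * `|b - a|.
Proof.
move=> p1 a0 b0 aM bM; rewrite ler_norml powR_sub_le// andbT lerNl opprB.
by rewrite distrC powR_sub_le.
Qed.

(** The remainder is nonnegative, and by the tangent inequality at [b] it is at most
    the increment of the derivative times the increment of the variable. *)
Lemma powR_taylor2 p a b M : 2 <= p -> 0 <= a -> 0 <= b -> a <= M -> b <= M ->
  `|b `^ p - a `^ p - p * a `^ (p - 1) * (b - a)| <=
  p * (p - 1) * M `^ (p - 2) * `|b - a| ^+ 2.
Proof.
move=> p2 a0 b0 aM bM; have p1 : 1 <= p by lra.
have p11 : 1 <= p - 1 by lra.
have h1 := powR_tangent p1 a0 b0; have h2 := powR_tangent p1 b0 a0.
have := powR_lipschitz p11 a0 b0 aM bM.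
rewrite (_ : p - 1 - 1 = p - 2); last by lra.
set K := M `^ (p - 2) => h3.
rewrite ger0_norm; last by lra.
apply: (@le_trans _ _ (p * ((b `^ (p - 1) - a `^ (p - 1)) * (b - a)))).
  by lra.
rewrite expr2 -!mulrA ler_wpM2l//; first by lra.
rewrite (le_trans (ler_norm _))// normrM !mulrA.
by rewrite ler_wpM2r.
Qed.

End PowerFunction.

(** * The norm of a uniformly smooth space and its duality map *)

Section SmoothNorm.
Context {R : realType} {E : normedModType R}.
Implicit Types (x k h : E) (phi psi : dual E).

Lemma dual_scale phi (a : R) x : phi (a *: x) = a * phi x.
Proof. exact: linearZ. Qed.

Lemma dual_scaleE (a : R) phi x : (a *: phi) x = a * phi x.
Proof. by []. Qed.

Lemma dual_subE phi psi x : (phi - psi) x = phi x - psi x.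
Proof. by []. Qed.

Lemma dual_of_contraction (N : E -> R^o) : linear N -> (forall k, `|N k| <= `|k|) ->
  exists phi : dual E, forall k, phi k = N k.
Proof.
move=> lN bN; pose L := GRing.isLinear.Build _ _ _ _ _ lN.
pose NL : {linear E -> R^o} := HB.pack N L.
have cN : continuous N.
  apply: (@linear_bounded_continuous _ _ _ NL).1.
  apply/linear_boundedP; exists 1; split; first exact: num_real.
  move=> r r1 x; rewrite (le_trans (bN x))// ler_peMl//; exact: ltW.
have pN : N \in dual_pred by apply/asboolP.
by exists (Dual pN).
Qed.

Lemma is_diff_epsP (g : E -> R^o) x phi :
  (forall e : R, 0 < e -> exists2 d : R, 0 < d & forall k, `|k| < d ->
     `|g (x + k) - g x - phi k| <= e * `|k|) ->
  is_diff x g phi.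
Proof.
move=> H.
have lo : g \o shift x = cst (g x) + (phi : E -> R^o) +o_ 0 id.
  apply/eqaddoP => e e0; have [d d0 dH] := H e e0.
  apply/nbhs_ballP; exists d => //= k; rewrite -ball_normE/= sub0r normrN => kd.
  by rewrite !fctE/= opprD addrA [k + x]addrC; exact: dH.
have dg := diff_unique (@dual_continuous _ _ phi) lo.
apply: DiffDef => //.
by apply/diff_locallyP; rewrite dg; split => //; exact: dual_continuous.
Qed.

Lemma is_diff_eps (g : E -> R^o) x phi : is_diff x g phi ->
  forall e : R, 0 < e -> exists2 d : R, 0 < d & forall k, `|k| < d ->
     `|g (x + k) - g x - phi k| <= e * `|k|.
Proof.
move=> [dg dE] e e0.
have [_ /eqaddoP/(_ e e0)/nbhs_ballP[d /= d0 dH]] := (diff_locallyP x g).1 dg.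
exists d => // k kd; have := dH k; rewrite -ball_normE/= sub0r normrN => /(_ kd).
by rewrite !fctE/= opprD addrA [k + x]addrC dE.
Qed.

(** The derivative of the norm at a unit vector, assembled from the directional
    limits: uniformity in the direction turns them into a Frechet derivative,
    and the two-sidedness of the limit turns sublinearity into linearity. *)
Lemma unit_norm_derivative (x0 : E) : uniformly_smooth E -> `|x0| = 1 ->
  exists phi : dual E, [/\ forall k, `|phi k| <= `|k|, phi x0 = 1 &
    forall e : R, 0 < e -> exists2 d : R, 0 < d & forall k, `|k| < d ->
     `| `|x0 + k| - `|x0| - phi k| <= e * `|k| ].
Proof.
move=> [D Dlim] x01.
pose N k : R^o := `|k| * D x0 (`|k|^-1 *: k).
have H1 (e : R) : 0 < e -> exists2 d : R, 0 < d & forall t h, `|h| = 1 ->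
    t != 0 -> `|t| < d ->
    `| `|x0 + t *: h| - 1 - t * D x0 h| <= e * `|t|.
  move=> e0; have := Dlim e e0; rewrite near_withinE => /nbhs_ballP[d /= d0 dH].
  exists d => // t h h1 t0 td.
  have := dH t; rewrite -ball_normE/= sub0r normrN => /(_ td t0 x0 h x01 h1).
  have -> : `|x0 + t *: h| - 1 - t * D x0 h =
      t * ((`|x0 + t *: h| - `|x0|) / t - D x0 h).
    by rewrite x01; field.
  by move=> /ltW X; rewrite normrM mulrC ler_wpM2r.
have H (e : R) : 0 < e -> exists2 d : R, 0 < d & forall k, `|k| < d ->
    `| `|x0 + k| - 1 - N k| <= e * `|k|.
  move=> e0; have [d d0 dH] := H1 e e0; exists d => // k kd.
  have [->|k0] := eqVneq k 0.
    by rewrite /N addr0 x01 normr0 mul0r mulr0 !subrr normr0.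
  have nk0 : `|k| != 0 by rewrite normr_eq0.
  have := dH `|k| (`|k|^-1 *: k).
  rewrite scalerA mulfV// scale1r normr_id; apply => //.
  by rewrite normrZ normfV normr_id mulVf.
have Ncvg k (e : R) : 0 < e -> exists2 d : R, 0 < d & forall t, `|t| < d ->
    `| `|x0 + t *: k| - 1 - N (t *: k)| <= e * `|t|.
  move=> e0; have k10 : 0 < `|k| + 1 by rewrite ltr_wpDl.
  have [d d0 dH] := H (e / (`|k| + 1)) (divr_gt0 e0 k10).
  exists (d / (`|k| + 1)); first exact: divr_gt0.
  move=> t; rewrite ltr_pdivlMr// => td.
  apply: le_trans (dH (t *: k) _) _.
    by rewrite normrZ (le_lt_trans _ td)// ler_wpM2l// lerDl.
  rewrite normrZ -mulrA ler_wpM2l ?(ltW e0)// mulrCA ler_piMr//.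
  by rewrite mulrC ler_pdivrMr// mul1r lerDl.
have Npos (c : R) k : 0 < c -> N (c *: k) = c * N k.
  move=> c0; rewrite /N normrZ gtr0_norm// -mulrA; congr (_ * (_ * D _ _)).
  by rewrite scalerA invfM mulrAC mulVf ?gt_eqF// mul1r.
(* [x0 + (- t) *: h] and [x0 + t *: (- h)] are the same point, so a two-sided limit
   is odd in the direction. *)
have NN k : N (- k) = - N k.
  apply/eqP; rewrite -addr_eq0 -normr_le0; apply/ler_addgt0Pr => e e0; rewrite add0r.
  have e20 : 0 < e / 2 by rewrite divr_gt0.
  have [->|k0] := eqVneq k 0.
    by rewrite /N oppr0 normr0 !mul0r addr0 normr0 ltW.
  have nk0 : 0 < `|k| by rewrite normr_gt0.
  have ek0 : 0 < e / 2 / `|k| by rewrite divr_gt0.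
  have [d d0 dH] := H1 _ ek0.
  have h1 : `| `|k|^-1 *: k| = 1.
    by rewrite normrZ normfV normr_id mulVf// gt_eqF.
  have d2 : 0 < d / 2 by rewrite divr_gt0.
  have nd2 : `|d / 2| < d by rewrite gtr0_norm// ltr_pdivrMr// ltr_pMr// ltr1n.
  have A1 := dH (- (d / 2)) _ h1.
  have A2 := dH (d / 2) (- (`|k|^-1 *: k)).
  rewrite normrN h1 in A2.
  have {}A1 := A1 _ _; have {}A2 := A2 _ _ _.
  rewrite oppr_eq0 normrN in A1.
  have d2n : d / 2 != 0 by rewrite gt_eqF.
  move: A1 => /(_ d2n nd2); move: A2 => /(_ erefl d2n nd2).
  rewrite /N normrN scalerN scaleNr scalerN.
  set a := D x0 (- _); set b := D x0 _; set c := `|x0 - _|.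
  rewrite [`|d / 2|]gtr0_norm// => A1 A2.
  have : `|d / 2 * (a + b)| <= (e / `|k|) * (d / 2).
    have -> : d / 2 * (a + b) = - (c - 1 - d / 2 * a) + (c - 1 - - (d / 2) * b).
      by lra.
    rewrite (le_trans (ler_normD _ _))// normrN.
    rewrite (le_trans (lerD A1 A2))//.
    by rewrite -mulrDl -mulrDl -splitr.
  rewrite normrM gtr0_norm// mulrC ler_pM2r// => A3.
  rewrite -mulrDr normrM normr_id mulrC -ler_pdivlMr//.
have NZ (c : R) k : N (c *: k) = c * N k.
  have [c0|c0|->] := ltgtP c 0.
  - rewrite -[c]opprK scaleNr NN Npos ?mulNr// oppr_gt0//.
  - exact: Npos.
  - by rewrite scale0r mul0r /N normr0 mul0r.
have Nsub k1 k2 : N (k1 + k2) <= N k1 + N k2.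
  apply/ler_addgt0Pr => e e0; have e4 : 0 < e / 5 by rewrite divr_gt0.
  have [d1 d10 dH1] := Ncvg (k1 + k2) _ e4.
  have [d2 d20 dH2] := Ncvg k1 _ e4.
  have [d3 d30 dH3] := Ncvg k2 _ e4.
  pose d := Num.min d1 (Num.min d2 d3).
  have dp : 0 < d by rewrite !lt_min d10 d20.
  pose t := d / 4.
  have t0 : 0 < t by rewrite divr_gt0.
  have t1 : `|t| < d1.
    rewrite gtr0_norm//; apply: (@lt_le_trans _ _ d).
      by rewrite ltr_pdivrMr// ltr_pMr// ltr1n.
    by rewrite ge_min lexx.
  have dd2 : d <= d2 by rewrite !ge_min lexx orbT.
  have dd3 : d <= d3 by rewrite !ge_min lexx !orbT.
  have t2 : `|2 * t| < d2 by rewrite gtr0_norm /t; lra.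
  have t3 : `|2 * t| < d3 by rewrite gtr0_norm /t; lra.
  move: (dH1 t t1) (dH2 _ t2) (dH3 _ t3); rewrite !NZ.
  have C : `|x0 + t *: (k1 + k2)| * 2 <=
      `|x0 + (2 * t) *: k1| + `|x0 + (2 * t) *: k2|.
    rewrite -(ler_pM2r (_ : 0 < 2^-1)) ?invr_gt0// mulfK ?pnatr_eq0//.
    have -> : x0 + t *: (k1 + k2) =
       2^-1 *: ((x0 + (2 * t) *: k1) + (x0 + (2 * t) *: k2)).
      rewrite addrACA -[x0 + x0]mulr2n -(scaler_nat 2 x0) -scalerDr -(scalerA 2 t) -scalerDr.
      by rewrite scalerA mulVf ?pnatr_eq0// scale1r.
    rewrite normrZ normfV [`|2|]gtr0_norm// mulrC ler_wpM2r// ?invr_ge0//.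
    exact: ler_normD.
  rewrite !ler_distl (gtr0_norm t0) (gtr0_norm (_ : 0 < 2 * t)) ?mulr_gt0//.
  move=> /andP[L1 _] /andP[_ L2] /andP[_ L3].
  have et := mulr_gt0 e0 t0.
  have : t * (N (k1 + k2)) <= t * (N k1 + N k2 + e) by lra.
  by rewrite ler_pM2l.
have Nadd k1 k2 : N (k1 + k2) = N k1 + N k2.
  apply/eqP; rewrite eq_le Nsub/=.
  have := Nsub (- k1) (- k2); rewrite -opprD !NN; lra.
have Nle k : `|N k| <= `|k|.
  have ub j : N j <= `|j|.
    apply/ler_addgt0Pr => e e0; have [d d0 dH] := Ncvg j e e0.
    have t0 : 0 < d / 2 by rewrite divr_gt0.
    have td : `|d / 2| < d by rewrite gtr0_norm//; lra.
    have := dH _ td; rewrite NZ ler_distl (gtr0_norm t0) => /andP[L _].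
    have L2 := ler_normD x0 ((d / 2) *: j).
    rewrite normrZ x01 (gtr0_norm t0) in L2.
    have : d / 2 * N j <= d / 2 * (`|j| + e) by lra.
    by rewrite ler_pM2l.
  by rewrite ler_norml ub andbT lerNl -NN -[leRHS]normrN ub.
have Nlin : linear N by move=> a u v; rewrite Nadd NZ.
have [phi phiE] := dual_of_contraction Nlin Nle.
exists phi; split => [k||e e0].
- by rewrite phiE.
- rewrite phiE; apply/eqP; rewrite -subr_eq0 -normr_le0; apply/ler_addgt0Pr => e e0.
  have [d d0 dH] := Ncvg x0 e e0.
  have t0 : 0 < d / 2 by rewrite divr_gt0.
  have td : `|d / 2| < d by rewrite gtr0_norm//; lra.
  have := dH _ td; rewrite NZ -{1}[x0]scale1r -scalerDl normrZ x01 mulr1.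
  rewrite gtr0_norm; last by lra.
  rewrite (gtr0_norm t0) (_ : _ - _ = - (d / 2 * (N x0 - 1))); last by lra.
  by rewrite normrN normrM (gtr0_norm t0) mulrC ler_pM2r// add0r.
- have [d d0 dH] := H e e0; exists d => // k kd.
  by rewrite phiE x01 dH.
Qed.

(** The functional [phi] has norm at most one and attains its norm at [x], so it also
    serves as the norming functional that Hahn-Banach would give. At [x = 0], where
    the norm is not differentiable, [phi = 0]. *)
Lemma norm_derivative x : uniformly_smooth E ->
  exists phi : dual E, [/\ forall k, `|phi k| <= `|k|, phi x = `|x| &
    x != 0 -> forall e : R, 0 < e -> exists2 d : R, 0 < d & forall k, `|k| < d ->
     `| `|x + k| - `|x| - phi k| <= e * `|k| ].
Proof.
move=> us; have [->|x0] := eqVneq x 0.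
  have z k : (0 : dual E) k = 0 by [].
  by exists 0; split => [k||/eqP//]; rewrite z normr0.
have nx : 0 < `|x| by rewrite normr_gt0.
have n1 : `| `|x|^-1 *: x| = 1 by rewrite normrZ normfV normr_id mulVf// gt_eqF.
have [phi [p1 p2 p3]] := unit_norm_derivative us n1.
exists phi; split => // [|_ e e0].
  by move: p2; rewrite dual_scale => /(congr1 ( *%R `|x|)); rewrite mulr1 mulVKf// gt_eqF.
have [d d0 dH] := p3 e e0; exists (d * `|x|); first exact: mulr_gt0.
move=> k; rewrite -ltr_pdivrMr// => kd.
have := dH (`|x|^-1 *: k).
rewrite normrZ normfV normr_id mulrC => /(_ kd).
rewrite -scalerDr !normrZ normfV normr_id dual_scale -!mulrBr normrM normfV normr_id.
by rewrite mulrA [X in _ <= X -> _]mulrC ler_pM2l ?invr_gt0.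
Qed.

End SmoothNorm.

Section PowerOfNorm.
Context {R : realType} {E : normedModType R}.
Implicit Types (x k h : E) (phi psi : dual E).
Variables (p : R) (us : uniformly_smooth E) (p2 : 2 <= p).

Let p0 : 0 < p. Proof. by rewrite (lt_le_trans _ p2). Qed.
Let p1 : 1 <= p. Proof. by rewrite (le_trans _ p2)// ler1n. Qed.

Let normp (y : E) : R^o := `|y| `^ p.

Lemma normp_subgradient_of x phi : (forall k, `|phi k| <= `|k|) -> phi x = `|x| ->
  forall y, normp x + (p * `|x| `^ (p - 1)) * phi (y - x) <= normp y.
Proof.
move=> phi1 phix y; apply: le_trans (powR_tangent p1 (normr_ge0 x) (normr_ge0 y)).
rewrite lerD2l ler_wpM2l ?mulr_ge0 ?powR_ge0 ?(ltW p0)//.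
by rewrite linearB/= phix lerB// (le_trans (ler_norm _)).
Qed.

(** Chain rule. The factor [`|x| `^ (p - 1)] vanishes at the origin, which is what
    makes the [p]-th power of the norm differentiable there as well. *)
Lemma normp_is_diff x : exists phi, [/\ forall k, `|phi k| <= `|k|, phi x = `|x| &
  is_diff x normp ((p * `|x| `^ (p - 1)) *: phi)].
Proof.
have [phi [phi1 phix phid]] := norm_derivative x us.
exists phi; split => //; apply: is_diff_epsP => e e0.
set c := p * `|x| `^ (p - 1).
have c0 : 0 <= c by rewrite mulr_ge0 ?powR_ge0 ?ltW.
have [d d0 dH] : exists2 d : R, 0 < d & forall k, `|k| < d ->
    `|c * (`|x + k| - `|x|) - c * phi k| <= e / 2 * `|k|.
  have [x0|x0] := eqVneq x 0.
    exists 1 => // k _; rewrite /c x0 normr0 powR0 ?subr_eq0; last first.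
      by rewrite gt_eqF// (lt_le_trans _ p2)// ltr1n.
    by rewrite !(mulr0, mul0r) subrr normr0 mulr_ge0// ltW// divr_gt0.
  have c1 : 0 < c + 1 by rewrite ltr_wpDl.
  have [d d0 dH] := phid x0 (e / 2 / (c + 1)) (divr_gt0 (divr_gt0 e0 (ltr0Sn _ 1)) c1).
  exists d => // k /dH; rewrite -mulrBr normrM (ger0_norm c0) => H.
  have {}H := ler_wpM2l c0 H; rewrite (le_trans H)//.
  rewrite [leLHS]mulrA ler_wpM2r// [leLHS]mulrA ler_pdivrMr//.
  by rewrite mulrC ler_wpM2l ?divr_ge0 ?(ltW e0)// lerDl.
pose M := `|x| + 1.
pose K := p * (p - 1) * M `^ (p - 2).
have K0 : 0 <= K by rewrite mulr_ge0 ?powR_ge0// mulr_ge0 ?subr_ge0 ?(ltW p0).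
pose d' := Num.min d (Num.min 1 (e / 2 / (K + 1))).
have K1 : 0 < K + 1 by rewrite ltr_wpDl.
exists d'; first by rewrite !lt_min d0 ltr01 !divr_gt0.
move=> k; rewrite !lt_min => /and3P[kd k1 kK].
have xkM : `|x + k| <= M by rewrite (le_trans (ler_normD _ _))// lerD2l ltW.
have xM : `|x| <= M by rewrite lerDl.
have H1 := powR_taylor2 p2 (normr_ge0 x) (normr_ge0 (x + k)) xM xkM.
have H2 := dH k kd.
rewrite dual_scaleE.
rewrite /normp (splitr e) mulrDl.
rewrite (_ : _ - _ - _ = (`|x + k| `^ p - `|x| `^ p - c * (`|x + k| - `|x|)) +
  (c * (`|x + k| - `|x|) - c * phi k)); last by lra.
rewrite (le_trans (ler_normD _ _))// lerD// (le_trans H1)//.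
have kk : `| `|x + k| - `|x| | <= `|k|.
  by rewrite (le_trans (ler_dist_dist _ _))// addrAC subrr add0r.
apply: (@le_trans _ _ (K * `|k| ^+ 2)).
  by rewrite ler_wpM2l// lerXn2r// nnegrE.
rewrite expr2 mulrA ler_wpM2r// mulrC.
have := ltW kK; rewrite ler_pdivlMr//; apply: le_trans.
by rewrite ler_wpM2l// lerDl.
Qed.

Let dnormp x : dual E := gradient normp x.

Lemma gradientP x : is_diff x normp (dnormp x).
Proof.
have [phi [_ _ d]] := normp_is_diff x.
rewrite /dnormp /gradient; case: xgetP => [psi _ //|/(_ _ d)//].
Qed.

(** Identities between gradients of convex functions, such as the homogeneity of
    [Jp], reduce by this lemma to inequalities without limits. *)
Lemma subgradient_unique (g : E -> R^o) x phi psi : is_diff x g phi ->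
  (forall y, g x + psi (y - x) <= g y) -> psi = phi.
Proof.
move=> dg sg; apply/val_inj/funext => /= k.
have le j : psi j <= phi j.
  apply/ler_addgt0Pr => e e0; have j1 : 0 < `|j| + 1 by rewrite ltr_wpDl.
  have [d d0 dH] := is_diff_eps dg (divr_gt0 e0 j1).
  pose t := d / 2 / (`|j| + 1).
  have t0 : 0 < t by rewrite !divr_gt0.
  have tj : `|t *: j| < d.
    rewrite normrZ gtr0_norm// /t mulrAC ltr_pdivrMr// -mulrA; nra.
  have := dH _ tj; have := sg (x + t *: j); rewrite addrAC subrr add0r.
  rewrite !dual_scale ler_distl => h1 /andP[_ h2].
  have : e / (`|j| + 1) * `|t *: j| <= e * t.
    rewrite normrZ gtr0_norm// mulrACA ler_piMr ?mulr_ge0 ?ltW//.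
    by rewrite mulrC ltr_pdivrMr// mul1r ltrDl.
  have : t * psi j <= t * (phi j + e) -> psi j <= phi j + e by rewrite ler_pM2l.
  by move=> H ?; apply: H; lra.
by apply/eqP; rewrite eq_le le/=; have := le (- k); rewrite !linearN/= lerN2.
Qed.

Lemma dnormpE x : exists phi, [/\ forall k, `|phi k| <= `|k|, phi x = `|x| &
  dnormp x = (p * `|x| `^ (p - 1)) *: phi].
Proof.
have [phi [h1 h2 h3]] := normp_is_diff x.
exists phi; split => //; apply: esym; apply: (subgradient_unique (gradientP x)).
exact: normp_subgradient_of.
Qed.

Lemma JpE x : p *: Jp p x = dnormp x.
Proof. by rewrite /Jp scalerA mulfV ?scale1r// gt_eqF. Qed.

Lemma Jp_subgradient x y : `|x| `^ p + p * Jp p x (y - x) <= `|y| `^ p.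
Proof.
have [phi [h1 h2 h3]] := dnormpE x.
rewrite -dual_scaleE JpE h3.
exact: normp_subgradient_of.
Qed.

(** Multiplying the subgradient inequality at [x] by [s `^ p] gives the one at
    [s *: x]. *)
Lemma Jp_scale (s : R) x : 0 < s -> Jp p (s *: x) = s `^ (p - 1) *: Jp p x.
Proof.
move=> s0; apply: (@scalerI _ _ p); first by rewrite gt_eqF.
rewrite JpE scalerA [p * _]mulrC -scalerA JpE; apply: esym; apply: (subgradient_unique (gradientP _)) => y.
have := Jp_subgradient x (s^-1 *: y).
rewrite -dual_scaleE JpE.
move=> /(ler_wpM2l (powR_ge0 s p)).
rewrite mulrDr /normp !normrZ normfV !(gtr0_norm s0) -!powRM ?mulr_ge0 ?invr_ge0 ?(ltW s0)//.
rewrite mulVKf ?gt_eqF//.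
rewrite dual_scaleE.
rewrite (_ : y - s *: x = s *: (s^-1 *: y - x)); last first.
  by rewrite scalerBr scalerA mulfV ?scale1r// gt_eqF.
rewrite dual_scale mulrA.
by rewrite [s `^ _ * s]mulrC mulr_powRB1// ltW.
Qed.

Lemma Jp_derivative x k (e : R) : 0 < e -> exists2 d : R, 0 < d &
  forall t : R, `|t| < d ->
    `| `|x + t *: k| `^ p - `|x| `^ p - t * (p * Jp p x k)| <= e * `|t|.
Proof.
move=> e0; have j1 : 0 < `|k| + 1 by rewrite ltr_wpDl.
have [d d0 dH] := is_diff_eps (gradientP x) (divr_gt0 e0 j1).
exists (d / (`|k| + 1)); first exact: divr_gt0.
move=> t; rewrite ltr_pdivlMr// => td.
have tk : `|t *: k| < d by rewrite normrZ (le_lt_trans _ td)// ler_wpM2l// lerDl.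
have := dH _ tk; rewrite -JpE dual_scale dual_scaleE => H.
rewrite (le_trans H)// normrZ -mulrA ler_pM2l// mulrCA ler_piMr//.
by rewrite mulrC ler_pdivrMr// mul1r lerDl.
Qed.

End PowerOfNorm.

(** On each interval the increment of [q] lies between the values of [dq] at the two
    ends, so the error telescopes to one step times the total variation of [dq]. *)
Lemma convex_right_sum {R : realType} (q dq : R -> R) (D : R) (n : nat) :
  0 <= D -> (forall s t, q s + dq s * (t - s) <= q t) ->
  `|q (D *+ n) - q 0 - D * \sum_(i < n) dq (D *+ i.+1)| <=
  D * (dq (D *+ n) - dq 0).
Proof.
move=> D0 cq; elim: n => [|n IH].
  by rewrite mulr0n big_ord0 !subrr mulr0 subrr normr0.
rewrite big_ord_recr/= mulrDr.
have h1 := cq (D *+ n) (D *+ n.+1); have h2 := cq (D *+ n.+1) (D *+ n).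
have e1 : D *+ n.+1 - D *+ n = D by rewrite mulrS addrK.
have e2 : D *+ n - D *+ n.+1 = - D by rewrite mulrS opprD addrCA subrr addr0.
rewrite e1 in h1; rewrite e2 in h2.
move: IH; rewrite !ler_norml => /andP[l1 l2]; apply/andP; split; nra.
Qed.

Section Riemann.
Context {R : realType} {E : normedModType R}.
Variables (p : R) (us : uniformly_smooth E) (p2 : 2 <= p).
Implicit Types (x v w z : E).

Let p0 : 0 < p. Proof. by rewrite (lt_le_trans _ p2). Qed.

(** The subgradient inequality between [x] and [x + v], and between [x] and
    [x - v]. *)
Lemma Jp_bound x v : `|p * Jp p x v| <= (`|x| + `|v|) `^ p.
Proof.
have h u : `|u| = `|v| -> p * Jp p x u <= (`|x| + `|v|) `^ p.
  move=> uv; have := Jp_subgradient us p2 x (x + u).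
  rewrite addrAC subrr add0r => h; have := powR_ge0 `|x| p => h2.
  apply: (@le_trans _ _ (`|x + u| `^ p)); first by lra.
  by rewrite ge0_ler_powR ?nnegrE ?addr_ge0 ?(ltW p0)// -uv ler_normD.
rewrite ler_norml h// andbT lerNl -mulrN -linearN h// normrN//.
Qed.

Lemma Jp_increment_bound z v M : `|z| <= M -> `|v| <= M ->
  `|(Jp p (z + v) - Jp p v) v| <= p^-1 * (2 * (3 * M) `^ p).
Proof.
move=> zM vM; rewrite ler_pdivlMl// -[X in X * _](gtr0_norm p0).
rewrite -normrM dual_subE mulrBr.
rewrite (le_trans (ler_normB _ _))// mulr2n mulrDl !mul1r.
have vz := ler_normD z v.
have v0 := normr_ge0 v; have z0 := normr_ge0 z.
by rewrite lerD// (le_trans (Jp_bound _ _))// ge0_ler_powR ?nnegrE ?addr_ge0// ?(ltW p0)//; lra.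
Qed.

(** The fundamental theorem of calculus for
    [s |-> |w + s v|^p - |s v|^p] on [[0, rho]], with a right Riemann sum in the place
    of the integral. Homogeneity of [Jp] moves the parameter [s] from [v] to [w], so
    that [v] enters the sum only through [(Jp p (z + v) - Jp p v) v] with [z] a
    multiple of [w]. Right ends keep [s > 0]. The rate depends on bounds
    for [w] and [v] only. *)
Lemma normp_increment_riemann (rho M D : R) (n : nat) w v :
  0 < rho -> `|w| <= M -> `|v| <= M -> D = rho / n.+1%:R ->
  `| `|w + rho *: v| `^ p - `|rho *: v| `^ p - `|w| `^ p -
     \sum_(i < n.+1) D * (p * (D *+ i.+1) `^ (p - 1)) *
        (Jp p ((D *+ i.+1)^-1 *: w + v) - Jp p v) v |
  <= D * (4 * ((rho + 2) * M) `^ p).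
Proof.
move=> rho0 wM vM DE; have D0 : 0 < D by rewrite DE divr_gt0.
have {}DE : D *+ n.+1 = rho by rewrite DE -(mulr_natr (rho / _)) divfK.
have M0 : 0 <= M by exact: le_trans vM.
have conv a : forall s t : R, `|a + s *: v| `^ p + p * Jp p (a + s *: v) v * (t - s)
    <= `|a + t *: v| `^ p.
  move=> s t; have := Jp_subgradient us p2 (a + s *: v) (a + t *: v).
  rewrite opprD addrACA subrr add0r -scalerBl dual_scale.
  by rewrite [(t - s) * _]mulrC mulrA.
have H1 := convex_right_sum n.+1 (ltW D0) (conv w).
have H2 := convex_right_sum n.+1 (ltW D0) (conv 0).
have bd a s : `|a| <= M -> 0 <= s -> s <= rho ->
    `|p * Jp p (a + s *: v) v| <= ((rho + 2) * M) `^ p.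
  move=> aM s0 sr; rewrite (le_trans (Jp_bound _ _))//.
  rewrite ge0_ler_powR ?nnegrE ?(ltW p0)// ?addr_ge0 ?mulr_ge0// ?addr_ge0 ?(ltW rho0)//.
  have : `|s *: v| <= rho * M by rewrite normrZ (ger0_norm s0) ler_pM.
  have := ler_normD a (s *: v); lra.
have z0 : `|0 : E| <= M by rewrite normr0.
have r0 := ltW rho0.
have b1 := bd w rho wM r0 (lexx _); have b2 := bd w 0 wM (lexx _) r0.
have b3 := bd 0 rho z0 r0 (lexx _); have b4 := bd 0 0 z0 (lexx _) r0.
rewrite !DE !scale0r !add0r addr0 in H1 H2 b1 b2 b3 b4.
rewrite normr0 powR0 ?gt_eqF// subr0 in H2.
have -> : \sum_(i < n.+1) D * (p * (D *+ i.+1) `^ (p - 1)) *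
        (Jp p ((D *+ i.+1)^-1 *: w + v) - Jp p v) v =
   D * \sum_(i < n.+1) p * Jp p (w + (D *+ i.+1) *: v) v -
   D * \sum_(i < n.+1) p * Jp p (0 + (D *+ i.+1) *: v) v.
  rewrite -mulrBr -sumrB mulr_sumr; apply: eq_bigr => i _.
  have s0 : 0 < D *+ i.+1 by rewrite pmulrn_lgt0.
  have -> : w + D *+ i.+1 *: v = D *+ i.+1 *: ((D *+ i.+1)^-1 *: w + v).
    by rewrite scalerDr scalerA mulfV ?scale1r// gt_eqF.
  rewrite add0r !Jp_scale// dual_subE.
  by move: (Jp p (_ + v)) (Jp p v) => a b; rewrite !dual_scaleE; ring.
move: H1 H2 b1 b2 b3 b4; set S1 := \sum_(i < _) _; set S2 := \sum_(i < _) _.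
set B := _ `^ p => H1 H2; rewrite !ler_norml => /andP[? ?] /andP[? ?] /andP[? ?] /andP[? ?].
move: H1 H2; rewrite !ler_norml => /andP[? ?] /andP[? ?]; apply/andP; split; nra.
Qed.

End Riemann.

(** * Strong measurability and Lebesgue integrals *)

Section StrongMeasurability.
Context {R : realType}.
Notation mu := (@lebesgue_measure R).
Implicit Types (V W : normedModType R) (I : set R).

Definition simple V (s : R -> V) :=
  finite_set (range s) /\ forall v, measurable (s @^-1` [set v]).

Lemma simple_preimage V (s : R -> V) (Y : set V) : simple s -> measurable (s @^-1` Y).
Proof.
move=> [fs ms].
have -> : s @^-1` Y = \bigcup_(v in range s `&` Y) (s @^-1` [set v]).
  apply/seteqP; split => [t Yt|t [v [_ Yv] /= E]]; last by rewrite /preimage/= E.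
  by exists (s t) => //; split => //; exists t.
by apply: fin_bigcup_measurable => //; exact: finite_setIl.
Qed.

Lemma simple_comp V W (h : V -> W) (s : R -> V) : simple s -> simple (h \o s).
Proof.
move=> ss; split; first by rewrite -(image_comp s h); apply: finite_image; case: ss.
by move=> w; rewrite comp_preimage; exact: simple_preimage.
Qed.

Lemma simple_measurable V (h : V -> R) (s : R -> V) D : simple s ->
  measurable_fun D (h \o s).
Proof.
move=> ss mD Y mY; apply: measurableI => //.
by rewrite comp_preimage; exact: simple_preimage.
Qed.

Lemma simple_add V (s s' : R -> V) : simple s -> simple s' -> simple (s \+ s').
Proof.
move=> [fs ms] [fs' ms']; split.
  apply: (@sub_finite_set _ _ ((fun q : V * V => q.1 + q.2) @` (range s `*` range s'))).
    by move=> _ [t _ <-]; exists (s t, s' t).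
  by apply: finite_image; exact: finite_setX.
move=> v.
have -> : (s \+ s') @^-1` [set v] =
    \bigcup_(u in range s) (s @^-1` [set u] `&` s' @^-1` [set v - u]).
  apply/seteqP; split => [t /= <-|t [u _ [/= <- ->]]].
    by exists (s t) => //; split => //=; rewrite addrAC subrr add0r.
  by rewrite addrC subrK.
by apply: fin_bigcup_measurable => // u _; exact: measurableI.
Qed.

Lemma strongly_measurable_simple V I (s : R -> V) : simple s -> strongly_measurable I s.
Proof. by move=> [h1 h2]; exists (fun=> s); split => // t _; exact: cvg_cst. Qed.

Lemma strongly_measurable_comp V W I (h : V -> W) (f : R -> V) : continuous h ->
  strongly_measurable I f -> strongly_measurable I (h \o f).
Proof.
move=> ch [s [ss sf]]; exists (fun n => h \o s n); split.
  by move=> n; have [? ?] := ss n; exact: simple_comp.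
by move=> t It; apply: (cvg_comp _ _ (sf t It)); exact: ch.
Qed.

Lemma strongly_measurable_add V I (f g : R -> V) : strongly_measurable I f ->
  strongly_measurable I g -> strongly_measurable I (f \+ g).
Proof.
move=> [s [ss sf]] [s' [ss' sg]]; exists (fun n => s n \+ s' n); split.
  by move=> n; apply: simple_add; [exact: ss|exact: ss'].
by move=> t It; apply: cvgD; [exact: sf|exact: sg].
Qed.

Lemma strongly_measurable_cst V I (v : V) : strongly_measurable I (cst v).
Proof.
apply: strongly_measurable_simple; split.
  by apply: (@sub_finite_set _ _ [set v]); [move=> _ [t _ <-]|exact: finite_set1].
by move=> w; rewrite preimage_cst; case: ifP => _; [exact: measurableT|exact: measurable0].
Qed.

Lemma strongly_measurable_scale V I (a : R) (f : R -> V) : strongly_measurable I f ->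
  strongly_measurable I (fun t => a *: f t).
Proof. exact: (strongly_measurable_comp (@scaler_continuous _ _ a)). Qed.

Lemma measurable_continuous_strongly V I (h : V -> R) (f : R -> V) :
  (forall v, h x @[x --> v] --> h v) ->
  strongly_measurable I f -> measurable_fun I (h \o f).
Proof.
move=> ch [s [ss sf]].
apply: (@measurable_fun_cvg _ _ _ _ (fun n => h \o s n)).
  by move=> n; exact: simple_measurable.
by move=> t It; apply: (cvg_comp _ _ (sf t It)); exact: ch.
Qed.

Lemma measurable_norm_strongly V I (f : R -> V) :
  strongly_measurable I f -> measurable_fun I (fun t => `|f t|).
Proof. by apply: measurable_continuous_strongly; exact: norm_continuous. Qed.

Lemma measurable_powR_norm V I (p : R) (f : R -> V) :
  strongly_measurable I f -> measurable_fun I (fun t => `|f t| `^ p).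
Proof.
move=> mf; apply: (measurableT_comp (measurable_powR p)).
exact: measurable_norm_strongly.
Qed.

(** The pairing is a pointwise limit of difference quotients of [`|a + b / n| `^ p]. *)
Lemma measurable_Jp V I (p : R) (a b : R -> V) : uniformly_smooth V -> 2 <= p ->
  strongly_measurable I a -> strongly_measurable I b ->
  measurable_fun I (fun t => Jp p (a t) (b t)).
Proof.
move=> us p2 ma mb; have p0 : p != 0 by rewrite gt_eqF// (lt_le_trans _ p2).
apply: (@measurable_fun_cvg _ _ _ _ (fun n t => p^-1 *
   (n.+1%:R * (`|a t + n.+1%:R^-1 *: b t| `^ p - `|a t| `^ p)))).
  move=> n; apply: measurable_funM => //; apply: measurable_funM => //.
  apply: measurable_funB; last exact: measurable_powR_norm.
  apply: measurable_powR_norm; apply: strongly_measurable_add => //.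
  exact: strongly_measurable_scale.
move=> t It; rewrite -[Jp p _ _](mulKf p0); apply: cvgMr.
apply/cvgrPdist_le => e e0; have [d d0 dH] := Jp_derivative us p2 (a t) (b t) e0.
have := near_infty_natSinv_lt (PosNum d0); apply: filterS => n /= nd.
have n0 : 0 < n.+1%:R^-1 :> R by rewrite invr_gt0.
have := dH n.+1%:R^-1; rewrite (gtr0_norm n0) => /(_ nd) h.
rewrite distrC -(ler_pM2r n0) -{2}(gtr0_norm n0) -normrM; apply: le_trans h.
rewrite le_eqVlt; apply/orP; left; apply/eqP; congr `|_|.
by field; rewrite gt_eqF// ltr0Sn.
Qed.

Lemma bounded_integrable D (f : R -> R) M : measurable D -> (mu D < +oo)%E ->
  measurable_fun D f -> (forall t, D t -> `|f t| <= M) ->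
  mu.-integrable D (EFin \o f).
Proof.
move=> mD Doo mf fM; apply: measurable_bounded_integrable => //.
exists M; split; first exact: num_real.
by move=> r Mr t Dt; exact: le_trans (fM t Dt) (ltW Mr).
Qed.

End StrongMeasurability.

Section IntegralFacts.
Context {R : realType}.
Notation mu := (@lebesgue_measure R).
Implicit Types (A D : set R) (f g F : R -> R).

Lemma integral_negative_null A F : measurable A -> mu.-integrable A (EFin \o F) ->
  (forall t, A t -> F t < 0) -> 0 <= \int[mu]_(t in A) F t -> mu A = 0%E.
Proof.
move=> mA iF Fneg Fint.
have iaF : mu.-integrable A (EFin \o (fun t => `|F t|)).
  by have := integrable_abse iF; apply: eq_integrable.
have H : \int[mu]_(t in A) `|F t| = - \int[mu]_(t in A) F t.
  rewrite -mulN1r -RintegralZl//; apply: eq_Rintegral => t /[!inE] At.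
  by rewrite ltr0_norm ?Fneg// mulN1r.
have H0 : \int[mu]_(t in A) `|F t| = 0.
  by apply/eqP; rewrite eq_le Rintegral_ge0// andbT H oppr_le0.
have : (\int[mu]_(t in A) `|(EFin \o F) t| = 0)%E.
  have -> : (\int[mu]_(t in A) `|(EFin \o F) t| = \int[mu]_(t in A) (`|F t|)%:E)%E.
    by apply: eq_integral => t _.
  rewrite -[LHS]fineK; last exact: integrable_fin_num.
  by rewrite -[fine _]/(Rintegral _ _ _) H0.
move=> /(ae_eq_integral_abs mu mA (measurable_int mu iF)).1 h.
apply: measure_negligible => //; apply: negligibleS h => t At /= /(_ At) [].
by apply/eqP; rewrite lt_eqF// Fneg.
Qed.

Lemma dist_Rintegral_le A f g (c : R) : measurable A -> (mu A < +oo)%E ->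
  mu.-integrable A (EFin \o f) -> mu.-integrable A (EFin \o g) ->
  (forall t, A t -> `|f t - g t| <= c) ->
  `|\int[mu]_(t in A) f t - \int[mu]_(t in A) g t| <= c * fine (mu A).
Proof.
move=> mA Aoo intf intg fg.
have ifg : mu.-integrable A (EFin \o (fun t => f t - g t)).
  by have := @integrableB _ _ _ mu _ mA _ _ intf intg; apply: eq_integrable => // t _; rewrite /= EFinB.
rewrite -RintegralB// (le_trans (le_normr_Rintegral _ _))//.
rewrite -Rintegral_cst//; apply: le_Rintegral => //.
  by have := integrable_abse ifg; apply: eq_integrable.
apply: (@bounded_integrable _ _ _ `|c|) => //.
Qed.

Lemma integrable_mull A f (k : R) : measurable A -> mu.-integrable A (EFin \o f) ->
  mu.-integrable A (EFin \o (fun t => k * f t)).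
Proof.
move=> mA intf; have := @integrableZl _ _ _ mu _ mA k _ intf.
by apply: eq_integrable => // t _; rewrite /= EFinM.
Qed.

Lemma ess_bounded_integrable (I : set R) (g : R -> R) (M : R) : measurable I ->
  (mu I < +oo)%E -> measurable_fun I g ->
  {ae mu, forall t, I t -> `|g t| <= M} -> mu.-integrable I (EFin \o g).
Proof.
move=> mI Ioo mg [N [mN N0 gN]].
have mD : measurable (I `\` N) by exact: measurableD.
apply/(negligible_integrable mN mI) => //; first exact/measurable_EFinP.
apply: (@bounded_integrable _ _ _ M) => //.
- by apply: le_lt_trans Ioo; apply: le_measure; rewrite ?inE//; exact: subDsetl.
- exact: measurable_funS mg.
- move=> t [It Nt]; apply: contrapT => gt; apply: Nt; apply: gN => /=.
  by move=> /(_ It).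
Qed.

End IntegralFacts.

Lemma ae_imply (R : realType) (P Q : R -> Prop) : (forall t, P t -> Q t) ->
  {ae @lebesgue_measure R, forall t, P t} -> {ae @lebesgue_measure R, forall t, Q t}.
Proof. by move=> PQ; apply: negligibleS => t /= nQ /PQ. Qed.

Lemma bounded_convergence (R : realType) (D : set R) (h : nat -> R -> R) (g : R -> R)
    (M : R) : let mu := @lebesgue_measure R in
  measurable D -> (mu D < +oo)%E -> (forall n, measurable_fun D (h n)) ->
  (forall n t, D t -> `|h n t| <= M) ->
  (forall t, D t -> h n t @[n --> \oo] --> g t) ->
  \int[mu]_(t in D) h n t @[n --> \oo] --> \int[mu]_(t in D) g t.
Proof.
move=> mu mD Doo mh hM hg.
have mg : measurable_fun D g by apply: (@measurable_fun_cvg _ _ _ _ h).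
have [|||||ig _ cv] := @dominated_convergence _ _ _ mu D mD (fun n => EFin \o h n)
  (EFin \o g) (EFin \o cst `|M|).
- by move=> n; apply/measurable_EFinP; exact: mh.
- by apply/measurable_EFinP.
- by apply: aeW => t Dt; apply: cvg_EFin; [by apply: nearW|exact: hg].
- by apply: (bounded_integrable (M := `|M|)) => // t _; rewrite normr_id.
- by apply: aeW => t n Dt; rewrite lee_fin (le_trans (hM n t Dt))// ler_norm.
apply: fine_cvg; rewrite fineK; last exact: integrable_fin_num.
exact: cv.
Qed.

(** * Weak limits of proximal inequalities *)

Section WeakLimit.
Context {R : realType} {E : normedModType R}.
Notation mu := (@lebesgue_measure R).
Variables (p : R) (us : uniformly_smooth E) (p2 : 2 <= p).
Variables (I : set R) (mI : measurable I) (Ioo : (mu I < +oo)%E).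

Let p0 : 0 < p. Proof. by rewrite (lt_le_trans _ p2). Qed.

Definition Jp_increment (z v : E) : R := (Jp p (z + v) - Jp p v) v.

Lemma measurable_Jp_increment A (z v : R -> E) : A `<=` I ->
  strongly_measurable I z -> strongly_measurable I v ->
  measurable_fun A (fun t => Jp_increment (z t) (v t)).
Proof.
move=> AI mz mv; apply: (measurable_funS mI AI).
apply: (@measurable_funB _ _ _ _ (fun t => Jp p (z t + v t) (v t))
  (fun t => Jp p (v t) (v t))); last exact: measurable_Jp.
by apply: measurable_Jp => //; exact: strongly_measurable_add.
Qed.

Section Limit.
Variables (x : nat -> R -> E) (y w : R -> E) (M : R).
Hypotheses (mx : forall n, strongly_measurable I (x n))
  (my : strongly_measurable I y) (mw : strongly_measurable I w)
  (xM : forall n t, I t -> `|x n t| <= M) (wM : forall t, I t -> `|w t| <= M).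
Hypothesis x_cvg : forall (z : R -> E) (phi : R -> R),
  in_Linfty I z -> mu.-integrable I (EFin \o phi) ->
  \int[mu]_(t in I) (Jp_increment (z t) (x n t) * phi t) @[n --> \oo] -->
  \int[mu]_(t in I) (Jp_increment (z t) (y t) * phi t).

Variables (A : set R) (mA : measurable A) (AI : A `<=` I)
  (yM : forall t, A t -> `|y t| <= M).

Let Aoo : (mu A < +oo)%E.
Proof. by apply: le_lt_trans Ioo; apply: le_measure; rewrite ?inE. Qed.

Let integrable_Jp_increment (s : R) v : strongly_measurable I v ->
  (forall t, A t -> `|v t| <= M) ->
  mu.-integrable A (EFin \o (fun t => Jp_increment (s *: w t) (v t))).
Proof.
move=> mv vM; pose N := Num.max 1 `|s| * M.
apply: (@bounded_integrable _ _ _ (p^-1 * (2 * (3 * N) `^ p))) => //.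
  by apply: measurable_Jp_increment => //; exact: strongly_measurable_scale.
move=> t At; have M0 : 0 <= M by rewrite (le_trans _ (vM t At)).
apply: Jp_increment_bound => //.
  by rewrite normrZ ler_pM// ?wM//; [rewrite le_max lexx orbT|exact: AI].
by rewrite (le_trans (vM t At))// ler_peMl// le_max lexx.
Qed.

Let cvg_Jp_increment (s : R) :
  \int[mu]_(t in A) (Jp_increment (s *: w t) (x n t)) @[n --> \oo] -->
  \int[mu]_(t in A) (Jp_increment (s *: w t) (y t)).
Proof.
have H v : \int[mu]_(t in A) (Jp_increment (s *: w t) (v t)) =
    \int[mu]_(t in I) (Jp_increment (s *: w t) (v t) * \1_A t).
  rewrite -(setIidr AI) Rintegral_mkcondr setIidr//; apply: eq_Rintegral => t _.
  by rewrite patchE indicE; case: ifP => _; rewrite ?mulr1 ?mulr0.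
rewrite H; under eq_cvg do rewrite H.
apply: (x_cvg (z := fun t => s *: w t) (phi := \1_A)); last first.
  apply: (@bounded_integrable _ _ _ 1) => // t _.
  by rewrite indicE ger0_norm ?ler0n// lern1; case: (_ \in _).
split; first exact: strongly_measurable_scale.
exists (`|s| * M); apply: aeW => t It; rewrite normrZ ler_wpM2l// wM//.
Qed.

Let integrable_sum_Jp_increment (c s : nat -> R) v m : strongly_measurable I v ->
  (forall t, A t -> `|v t| <= M) -> mu.-integrable A
  (EFin \o (fun t => \sum_(i < m) c i * Jp_increment (s i *: w t) (v t))).
Proof.
move=> mv vM; have := @integrable_sum _ _ _ mu _ mA 'I_m (index_enum _) xpredT
  (fun i t => (c i * Jp_increment (s i *: w t) (v t))%:E).
move=> H; apply: eq_integrable (H _) => //.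
  by move=> t _; rewrite /= sumEFin.
by move=> i _; apply: integrable_mull => //; exact: integrable_Jp_increment.
Qed.

Let cvg_sum_Jp_increment (c s : nat -> R) m :
  \int[mu]_(t in A) (\sum_(i < m) c i * Jp_increment (s i *: w t) (x n t)) @[n --> \oo] -->
  \int[mu]_(t in A) (\sum_(i < m) c i * Jp_increment (s i *: w t) (y t)).
Proof.
elim: m => [|m IH].
  rewrite [X in _ --> X](_ : _ = 0); last first.
    by under eq_Rintegral do rewrite big_ord0; rewrite Rintegral_cst// mul0r.
  apply: cvg_near_cst; apply: nearW => n.
  by under eq_Rintegral do rewrite big_ord0; rewrite Rintegral_cst// mul0r.
have H v : strongly_measurable I v -> (forall t, A t -> `|v t| <= M) ->
   \int[mu]_(t in A) (\sum_(i < m.+1) c i * Jp_increment (s i *: w t) (v t)) =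
   \int[mu]_(t in A) (\sum_(i < m) c i * Jp_increment (s i *: w t) (v t)) +
   c m * \int[mu]_(t in A) (Jp_increment (s m *: w t) (v t)).
  move=> mv vM; rewrite -RintegralZl//; last exact: integrable_Jp_increment.
  rewrite -RintegralD//.
  - by apply: eq_Rintegral => t _; rewrite big_ord_recr.
  - exact: integrable_sum_Jp_increment.
  - by apply: integrable_mull => //; exact: integrable_Jp_increment.
rewrite H//; under eq_cvg => n do (rewrite H//; last by move=> t /AI; exact: xM).
by apply: cvgD => //; apply: cvgMr; exact: cvg_Jp_increment.
Qed.

Variables (rho : R) (rho0 : 0 < rho).

Let Psi v t := `|w t + rho *: v t| `^ p - `|rho *: v t| `^ p - `|w t| `^ p.

Lemma integrable_normp_increment v : strongly_measurable I v ->
  (forall t, A t -> `|v t| <= M) -> mu.-integrable A (EFin \o Psi v).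
Proof.
move=> mv vM; pose B := ((1 + rho) * M) `^ p.
have r0 := ltW rho0.
apply: (@bounded_integrable _ _ _ (B + B + B)) => //.
  apply: (measurable_funS mI AI); apply: measurable_funB; last exact: measurable_powR_norm.
  apply: measurable_funB; apply: measurable_powR_norm.
    by apply: strongly_measurable_add => //; exact: strongly_measurable_scale.
  exact: strongly_measurable_scale.
move=> t At; have M0 : 0 <= M by rewrite (le_trans _ (vM t At)).
have b (u : E) : `|u| <= (1 + rho) * M -> `| `|u| `^ p| <= B.
  move=> uM; rewrite ger0_norm ?powR_ge0// ge0_ler_powR ?nnegrE// ?(ltW p0)//.
  by rewrite mulr_ge0 ?addr_ge0.
have wt := wM (AI At); have vt := vM t At.
have rv : `|rho *: v t| <= rho * M by rewrite normrZ (gtr0_norm rho0) ler_wpM2l.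
have rM := mulr_ge0 r0 M0.
rewrite (le_trans (ler_normB _ _))// lerD ?b//; last lra.
rewrite (le_trans (ler_normB _ _))// lerD ?b//; last lra.
by rewrite (le_trans (ler_normD _ _))//; lra.
Qed.

(** Each Riemann sum of [normp_increment_riemann] has a convergent integral, and the
    sums approximate uniformly in [n] and [t]; so the limits may be exchanged. *)
Lemma cvg_normp_increment :
  \int[mu]_(t in A) Psi (x n) t @[n --> \oo] --> \int[mu]_(t in A) Psi y t.
Proof.
apply/cvgrPdist_le => e e0; set a := fine (mu A).
have a0 : 0 <= a by rewrite fine_ge0.
pose B := 4 * ((rho + 2) * M) `^ p.
have B0 : 0 <= B by rewrite mulr_ge0 ?powR_ge0.
have Ba : 0 < rho * (B * a) + 1 by rewrite ltr_wpDl// mulr_ge0 ?(ltW rho0)// mulr_ge0.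
have eBa : 0 < e / 3 / (rho * (B * a) + 1) by rewrite !divr_gt0.
have [N _ /(_ N (leqnn N)) NE] := near_infty_natSinv_lt (PosNum eBa).
rewrite /= in NE.
pose D : R := rho / N.+1%:R.
pose c (i : nat) : R := D * (p * (D *+ i.+1) `^ (p - 1)).
pose s (i : nat) : R := (D *+ i.+1)^-1.
have De : D * B * a <= e / 3.
  have -> : D * B * a = rho * (B * a) * N.+1%:R^-1 by rewrite /D; ring.
  move: NE => /ltW; rewrite ler_pdivlMr// => NE.
  apply: le_trans NE; rewrite [leRHS]mulrC ler_wpM2r// ?invr_ge0//.
  by rewrite lerDl.
have approx v : strongly_measurable I v -> (forall t, A t -> `|v t| <= M) ->
   `| \int[mu]_(t in A) Psi v t -
      \int[mu]_(t in A) (\sum_(i < N.+1) c i * Jp_increment (s i *: w t) (v t)) | <= e / 3.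
  move=> mv vM; apply: le_trans De; apply: dist_Rintegral_le => //.
  - exact: integrable_normp_increment.
  - exact: integrable_sum_Jp_increment.
  - move=> t At; apply: (normp_increment_riemann us p2 rho0) => //.
    + by apply: wM; exact: AI.
    + exact: vM.
have := @cvg_sum_Jp_increment c s N.+1.
move=> /cvgrPdist_le /(_ (e / 3) (divr_gt0 e0 (ltr0Sn R 2))).
apply: filterS => n h.
have xA t : A t -> `|x n t| <= M by move=> /AI; exact: xM.
have h1 := approx _ my yM; have h2 := approx _ (mx n) xA.
move: h h1 h2; set S1 := \int[mu]_(_ in _) _; set S2 := \int[mu]_(_ in _) _.
set S3 := \int[mu]_(_ in _) _; set S4 := \int[mu]_(_ in _) _.
rewrite !ler_norml => /andP[? ?] /andP[? ?] /andP[? ?]; apply/andP; split; lra.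
Qed.

End Limit.

(** The hypothesis is raised to the power [p], where the tangent inequality makes the
    error [delta] linear, and integrated over the set where the conclusion fails
    and [y] is bounded. In the limit the integral of a negative function over
    this set is nonnegative, so the set is null. *)
Lemma weak_limit_proximal (x : nat -> R -> E) (y w : R -> E) (delta : R -> R)
    (eps : nat -> R) (M N rho : R) : 0 < rho ->
  (forall n, strongly_measurable I (x n)) -> in_Linfty I y ->
  strongly_measurable I w -> measurable_fun I delta ->
  (forall n t, I t -> `|x n t| <= M) -> (forall t, I t -> `|w t| <= N) ->
  (forall t, I t -> 0 <= delta t <= N) ->
  (forall n, 0 <= eps n) -> eps n @[n --> \oo] --> (0 : R) ->
  (forall n t, I t -> `|rho *: x n t| - delta t - eps n <= `|w t + rho *: x n t|) ->
  (forall (z : R -> E) (phi : R -> R),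
    in_Linfty I z -> mu.-integrable I (EFin \o phi) ->
    \int[mu]_(t in I) (Jp_increment (z t) (x n t) * phi t) @[n --> \oo] -->
    \int[mu]_(t in I) (Jp_increment (z t) (y t) * phi t)) ->
  {ae mu, forall t, I t -> `|rho *: y t| `^ p - p * (rho * M) `^ (p - 1) * delta t <=
     `|w t + rho *: y t| `^ p}.
Proof.
move=> rho0 mx [my [My yMy]] mw mdelta xM wM deltaM eps0 epscvg prox xcvg.
set K := p * (rho * M) `^ (p - 1).
have K0 : 0 <= K by rewrite mulr_ge0 ?powR_ge0// ltW.
pose M' := Num.max M (Num.max N My).
pose F t := `|w t + rho *: y t| `^ p - `|rho *: y t| `^ p + K * delta t.
have mF : measurable_fun I F.
  apply: measurable_funD; last exact: measurable_funM.
  apply: measurable_funB; apply: measurable_powR_norm; last exact: strongly_measurable_scale.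
  by apply: strongly_measurable_add => //; exact: strongly_measurable_scale.
(* [y] is bounded by [My] only almost everywhere, but the integral estimates need a
   pointwise bound on [A]. *)
pose A := (I `&` (fun t => `|y t|) @^-1` `]-oo, M']) `&` (I `&` F @^-1` `]-oo, 0[).
have mA : measurable A.
  apply: measurableI; [|exact: (mF mI)].
  exact: (measurable_norm_strongly my mI).
have AI : A `<=` I by move=> t [[]].
have Aoo : (mu A < +oo)%E by apply: le_lt_trans Ioo; apply: le_measure; rewrite ?inE.
suff muA : mu A = 0%E.
  have nA : mu.-negligible A by apply/negligibleP.
  have nU := negligibleU nA yMy; apply: negligibleS nU => t /= /not_implyP[It].
  move=> /negP; rewrite -ltNge => Ft.
  have [yt|yt] := leP `|y t| My; last first.
    by right => /(_ It).
  left; split; split => //=; rewrite in_itv/=.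
    by rewrite /M' !le_max yt !orbT.
  by rewrite /F; lra.
have wM' t : I t -> `|w t| <= M' by move=> /wM h; rewrite !le_max h orbT.
have xM' n t : I t -> `|x n t| <= M' by move=> /xM h; rewrite le_max h.
have yM' t : A t -> `|y t| <= M' by move=> [[_ /=]]; rewrite in_itv.
have xM'A n t : A t -> `|x n t| <= M' by move=> /AI; exact: xM'.
have deltaM' t : I t -> `|delta t| <= M'.
  by move=> /deltaM/andP[h h']; rewrite ger0_norm// !le_max h' orbT.
pose G t := `|w t| `^ p + K * delta t.
have iG : mu.-integrable A (EFin \o G).
  apply: (@bounded_integrable _ _ _ (M' `^ p + K * M')) => //.
    apply: (measurable_funS mI AI); apply: measurable_funD; last exact: measurable_funM.
    exact: measurable_powR_norm.
  move=> t /AI It; rewrite (le_trans (ler_normD _ _))// normrM (ger0_norm K0).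
  rewrite (ger0_norm (powR_ge0 _ _)) lerD//; last by rewrite ler_wpM2l// deltaM'.
  have wt := wM' t It.
  by rewrite ge0_ler_powR ?nnegrE ?(ltW p0)// (le_trans _ wt).
pose Psi v t := `|w t + rho *: v t| `^ p - `|rho *: v t| `^ p - `|w t| `^ p.
have iPsi v : strongly_measurable I v -> (forall t, A t -> `|v t| <= M') ->
  mu.-integrable A (EFin \o Psi v).
  by move=> mv vM; exact: (integrable_normp_increment mw wM').
have iF : mu.-integrable A (EFin \o F).
  have := @integrableD _ _ _ mu _ mA _ _ (iPsi _ my yM') iG; apply: eq_integrable => //.
  by move=> t _ /=; rewrite -EFinD /Psi /G /F; congr EFin; ring.
apply: (integral_negative_null mA iF); first by move=> t [_ [_ /=]]; rewrite in_itv.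
have FE : \int[mu]_(t in A) F t = \int[mu]_(t in A) Psi y t + \int[mu]_(t in A) G t.
  rewrite -RintegralD//; last exact: iPsi.
  by apply: eq_Rintegral => t _; rewrite /F /Psi /G; ring.
set a := fine (mu A).
have lower n : - (K * eps n * a) <= \int[mu]_(t in A) Psi (x n) t + \int[mu]_(t in A) G t.
  rewrite -RintegralD//; last exact: (iPsi _ (mx n) (xM'A n)).
  have -> : - (K * eps n * a) = \int[mu]_(t in A) (- (K * eps n)).
    by rewrite Rintegral_cst// mulNr.
  apply: le_Rintegral => //.
  - by apply: (@bounded_integrable _ _ _ `|- (K * eps n)|).
  - have := @integrableD _ _ _ mu _ mA _ _ (iPsi _ (mx n) (xM'A n)) iG; apply: eq_integrable => //.
  move=> t At; have It := AI _ At.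
  have tg := powR_tangent (le_trans (ler1n R 2) p2) (normr_ge0 (rho *: x n t))
     (normr_ge0 (w t + rho *: x n t)).
  have pr := prox n t It.
  set b := `|rho *: x n t| in tg pr *; set d := `|w t + _| in tg pr *.
  have bM : b <= rho * M by rewrite /b normrZ gtr0_norm// ler_wpM2l ?(ltW rho0)// xM.
  have bK : p * b `^ (p - 1) <= K.
    rewrite ler_wpM2l ?(ltW p0)// ge0_ler_powR ?nnegrE//.
    - by rewrite subr_ge0 (le_trans _ p2)// ler1n.
    - exact: normr_ge0.
    - exact: le_trans (normr_ge0 _) bM.
  have bp : 0 <= p * b `^ (p - 1) by rewrite mulr_ge0 ?powR_ge0// ltW.
  have /andP[dt0 _] := deltaM t It; have e0 := eps0 n.
  rewrite /Psi /G -/b -/d.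
  have s1 : p * b `^ (p - 1) * (- (delta t + eps n)) <= p * b `^ (p - 1) * (d - b).
    by rewrite ler_wpM2l//; lra.
  have s2 : p * b `^ (p - 1) * (delta t + eps n) <= K * (delta t + eps n).
    by rewrite ler_wpM2r// addr_ge0.
  lra.
have cvgPsi : \int[mu]_(t in A) Psi (x n) t @[n --> \oo] --> \int[mu]_(t in A) Psi y t.
  exact: (cvg_normp_increment mx my mw xM' wM' xcvg mA AI yM' rho0).
rewrite FE.
have l1 : - (K * eps n * a) @[n --> \oo] --> - (K * 0 * a).
  by apply: cvgN; apply: cvgMl; apply: cvgMr.
have l2 : \int[mu]_(t in A) Psi (x n) t + \int[mu]_(t in A) G t @[n --> \oo] -->
    \int[mu]_(t in A) Psi y t + \int[mu]_(t in A) G t.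
  by apply: cvgD cvgPsi (cvg_cst _).
rewrite mulr0 mul0r oppr0 in l1.
exact: (ler_cvg_to l1 l2 (nearW _ lower)).
Qed.

End WeakLimit.

(** * Almost everywhere differentiability of an integral curve *)

Section AeDerivative.
Context {R : realType} {E : normedModType R}.
Notation mu := (@lebesgue_measure R).

Lemma separable_sequence : separable E ->
  exists d : nat -> E, forall (x : E) (e : R), 0 < e -> exists n, `|x - d n| < e.
Proof.
move=> [D cD dD].
have D0 : D !=set0.
  have [//||x []] := dD setT; [by exists 0|exact: openT|by exists x].
have /pfcard_geP[D00|[f]] := cD; first by move: D0; rewrite D00 => -[].
exists f => x e e0.
have [] := dD (ball x e).
- by exists x; exact: ballxx.
- exact: ball_open.
move=> y [+ Dy]; rewrite -ball_normE /= => xy.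
by have [n _ nE] := @surj _ _ _ _ f y Dy; exists n; rewrite nE.
Qed.

Variable us : uniformly_smooth E.

Lemma norm_le_dual (x : E) (c : R) :
  (forall phi : dual E, (forall k, `|phi k| <= `|k|) -> `|phi x| <= c) -> `|x| <= c.
Proof.
move=> H; have [phi [h1 h2 _]] := norm_derivative x us.
by rewrite -h2 (le_trans (ler_norm _))// H.
Qed.

Variables (T : R) (U w : R -> E).
Hypotheses (sepE : separable E) (mw : strongly_measurable `[0, T] w)
  (iw : mu.-integrable `[0, T] (EFin \o (fun t => `|w t|))).
Hypothesis Uw : forall (phi : dual E) t, 0 <= t <= T ->
  phi (U t - U 0) = \int[mu]_(s in `[0, t]) phi (w s).

Let integrable_dual (phi : dual E) : (forall k, `|phi k| <= `|k|) ->
  mu.-integrable `[0, T] (EFin \o (fun t => phi (w t))).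
Proof.
move=> phi1; apply: (@le_integrable _ _ _ mu) iw => //.
  apply/measurable_EFinP; apply: measurable_continuous_strongly => //.
  exact: dual_continuous.
by move=> t _; rewrite lee_fin normr_id.
Qed.

Let integrable_dist (v : E) :
  mu.-integrable `[0, T] (EFin \o (fun t => `|w t - v|)).
Proof.
have iv : mu.-integrable `[0, T] (EFin \o cst `|v|).
  apply: (@bounded_integrable _ _ _ `|v|) => //.
  - by rewrite /= lebesgue_measure_itv/=; case: ifP => _; rewrite ltry.
  - by move=> t _; rewrite normr_id.
have := @integrableD _ _ _ mu _ (measurable_itv _) _ _ iw iv.
apply: le_integrable => //.
  apply/measurable_EFinP; apply: measurable_norm_strongly.
  by apply: strongly_measurable_add => //; exact: strongly_measurable_cst.
move=> t _; rewrite /= lee_fin normr_id ger0_norm ?addr_ge0//; exact: ler_normB.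
Qed.

Let subitv (s t : R) : 0 <= s -> t <= T -> `]s, t] `<=` `[0, T].
Proof.
move=> s0 tT u /=; rewrite !in_itv/= => /andP[su ut].
by rewrite (le_trans s0 (ltW su)) (le_trans ut tT).
Qed.

Let integrable_sub (f : R -> R) (s t : R) : 0 <= s -> t <= T ->
  mu.-integrable `[0, T] (EFin \o f) -> mu.-integrable `]s, t] (EFin \o f).
Proof. by move=> s0 tT; apply: integrableS => //; exact: subitv. Qed.

(** Testing with functionals of norm at most one replaces a vector-valued integral:
    only scalar functions are integrated. *)
Lemma increment_le (s t : R) (v d : E) : 0 <= s -> s <= t -> t <= T ->
  `|U t - U s - (t - s) *: v| <=
  \int[mu]_(x in `]s, t]) `|w x - d| + (t - s) * `|d - v|.
Proof.
move=> s0 st tT; apply: norm_le_dual => phi phi1.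
have iphi := integrable_dual phi1.
have fin_mu : (mu `]s, t] < +oo)%E.
  by rewrite lebesgue_measure_itv/=; case: ifP => _; rewrite -?EFinB ltry.
have mu_st : fine (mu `]s, t]) = t - s.
  rewrite lebesgue_measure_itv/= lte_fin; case: ltP => //= ts.
  by apply/eqP; rewrite eq_sym subr_eq0 eq_le ts st.
have E1 : phi (U t - U s) = \int[mu]_(x in `]s, t]) phi (w x).
  have -> : U t - U s = (U t - U 0) - (U s - U 0) by rewrite opprB addrA subrK.
  rewrite linearB/= !Uw ?s0 ?tT ?(le_trans s0 st) ?(le_trans st tT)//.
  rewrite -(@Rintegral_itvB _ _ (BLeft 0) (BRight t))//.
  by apply: integrableS iphi => //; apply: subset_itvl; rewrite bnd_simp.
have icst (c : R) : mu.-integrable `]s, t] (EFin \o cst c).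
  by apply: (@bounded_integrable _ _ _ `|c|).
have -> : phi (U t - U s - (t - s) *: v) = \int[mu]_(x in `]s, t]) (phi (w x) - phi v).
  rewrite (RintegralB _ (integrable_sub s0 tT iphi) (icst (phi v)))//.
  by rewrite Rintegral_cst// mu_st linearB/= E1 dual_scale mulrC.
have i1 : mu.-integrable `]s, t] (EFin \o (fun x => phi (w x) - phi v)).
  have := @integrableB _ _ _ mu _ (measurable_itv _) _ _ (integrable_sub s0 tT iphi) (icst (phi v)).
  by apply: eq_integrable.
have i2 := integrable_sub s0 tT (integrable_dist d).
rewrite (le_trans (le_normr_Rintegral _ i1))//.
have -> : (t - s) * `|d - v| = \int[mu]_(x in `]s, t]) `|d - v|.
  by rewrite Rintegral_cst// mu_st mulrC.
rewrite -(RintegralD _ i2 (icst `|d - v|))//; apply: le_Rintegral => //.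
- by have := integrable_abse i1; apply: eq_integrable.
- by have := @integrableD _ _ _ mu _ (measurable_itv _) _ _ i2 (icst `|d - v|); apply: eq_integrable.
- move=> x _; rewrite -linearB (le_trans (phi1 _))//.
  by rewrite (le_trans _ (ler_normD _ _))// addrA subrK.
Qed.

(** Where every [G j], a primitive of [`|w - d j|], is differentiable with the right
    derivative, [increment_le] with [v = w t] bounds the error of the difference
    quotient of [U] by about [2 * `|w t - d j|], which is as small as
    one likes since [d] is dense. *)
Lemma ae_derivable :
  {ae mu, forall t, t \in `[0, T] -> derivable U t 1 /\ derive1 U t = w t}.
Proof.
have [d dd] := separable_sequence sepE.
pose g j : R -> R := (fun t : R => `|w t - d j|) \_ `[0, T].
pose G j (x : R) : R := \int[mu]_(t in `]-oo, x]) g j t.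
have ig j : mu.-integrable setT (EFin \o g j).
  have : mu.-integrable setT ((EFin \o (fun t => `|w t - d j|)) \_ `[0, T]).
    by apply/(integrable_mkcond _ _).1 => //; exact: integrable_dist.
  by apply: eq_integrable => // t _; rewrite /g restrict_EFin.
have iNy j y : mu.-integrable `]-oo, y] (EFin \o g j).
  by apply: integrableS (ig j) => //; exact: subsetT.
have aeG : {ae mu, forall t : R, forall j, derivable (G j) t 1 /\ derive1 (G j) t = g j t}.
  apply/ae_foralln => j; apply: FTC1Ny => //.
  by apply: integrable_locally => //; exact: integrable_dist.
have Gincr j s t : 0 <= s -> s <= t -> t <= T ->
    G j t - G j s = \int[mu]_(x in `]s, t]) `|w x - d j|.
  move=> s0 st tT; rewrite /G Rintegral_itvB//.
  apply: eq_Rintegral => x /[!inE] xst; rewrite /g patchE mem_set//.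
  exact: subitv xst.
have n0 : mu.-negligible [set (0 : R)] by apply/negligibleP => //; exact: lebesgue_measure_set1.
have nT : mu.-negligible [set T] by apply/negligibleP => //; exact: lebesgue_measure_set1.
have := negligibleU (negligibleU n0 nT) aeG; apply: negligibleS => t /=.
move=> ntP; apply: contrapT => /not_orP[/not_orP[t0 tT]] /contrapT Gt.
apply: ntP => tI.
have {t0 tT tI} [t0 tT] : 0 < t /\ t < T.
  move: tI; rewrite in_itv/= => /andP[a b].
  by rewrite !lt_neqAle a b; split; rewrite andbT; apply/eqP => // /esym.
have key : (h^-1 *: (U (h + t) - U t)) @[h --> 0^'] --> w t.
  apply/cvgrPdist_le => e e0; have e3 : 0 < e / 3 by rewrite divr_gt0.
  have [j dj] := dd (w t) _ e3; have [dG dGE] := Gt j.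
  have wI : t \in `[0, T] by rewrite in_itv/= !ltW.
  have gt : g j t = `|w t - d j| by rewrite /g patchE mem_set.
  have cG : h^-1 *: (G j (h + t) - G j t) @[h --> 0^'] --> g j t.
    rewrite -dGE derive1E; move: dG; rewrite /derivable /derive.
    suff -> : (fun h : R => h^-1 *: ((G j \o shift t) (h *: 1) - G j t)) =
      (fun h => h^-1 *: (G j (h + t) - G j t)) by [].
    by apply/funext => h /=; rewrite [h *: 1]mulr1.
  have b1 : \forall h \near 0^', `|g j t - h^-1 *: (G j (h + t) - G j t)| <= e / 3.
    by move/cvgrPdist_le : cG; apply.
  have b2 : \forall h \near 0^', h != 0 :> R by apply: nbhs_dnbhs_neq.
  have b3 : \forall h \near (0 : R)^', 0 < h + t < T.
    apply: nbhs_dnbhs; apply/nbhs_ballP; exists (Num.min t (T - t)) => /=.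
      by rewrite lt_min t0 subr_gt0.
    move=> h; rewrite -ball_normE/= sub0r normrN lt_min !ltr_norml.
    move=> /andP[/andP[h1 _] /andP[_ h2]]; apply/andP; split; lra.
  near=> h.
  have h0 : h != 0 by near: h.
  have /andP[ht hT] : 0 < h + t < T by near: h.
  have bh : `|g j t - h^-1 *: (G j (h + t) - G j t)| <= e / 3 by near: h.
  have inc : `|U (h + t) - U t - h *: w t| <=
      `|G j (h + t) - G j t| + `|h| * `|d j - w t|.
    have [hp|hn] := ltP 0 h.
      have tht : t <= h + t by rewrite lerDr ltW.
      have := increment_le (w t) (d j) (ltW t0) tht (ltW hT).
      rewrite addrK -Gincr// ?(ltW t0) ?(ltW hT)// (gtr0_norm hp) => /le_trans; apply.
      by rewrite lerD2r ler_norm.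
    have tht : h + t <= t by rewrite gerDr.
    have := increment_le (w t) (d j) (ltW ht) tht (ltW tT).
    rewrite -Gincr// ?(ltW ht) ?(ltW tT)//.
    rewrite (_ : t - (h + t) = - h); last by lra.
    rewrite scaleNr opprK (ler0_norm hn) -[X in _ -> X <= _]normrN opprD opprK opprB.
    move=> /le_trans; apply.
    by rewrite lerD2r -normrN opprB ler_norm.
  have hpos : 0 < `|h| by rewrite normr_gt0.
  have -> : w t - h^-1 *: (U (h + t) - U t) = - (h^-1 *: (U (h + t) - U t - h *: w t)).
    by rewrite [in RHS]scalerBr scalerA mulVf// scale1r opprB.
  rewrite normrN normrZ normfV ler_pdivrMl//.
  rewrite (le_trans inc)//.
  have : `|G j (h + t) - G j t| <= `|h| * (g j t + e / 3).
    rewrite -ler_pdivrMl// -normfV -normrM.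
    have := ler_normD (h^-1 *: (G j (h + t) - G j t) - g j t) (g j t).
    rewrite subrK => /le_trans; apply; rewrite addrC lerD//; last by rewrite distrC.
    by rewrite gt normr_id.
  rewrite gt (distrC (d j)) => h3.
  apply: (@le_trans _ _ (`|h| * (`|w t - d j| + e / 3 + `|w t - d j|))).
    by rewrite [leRHS]mulrDr lerD2r.
  rewrite ler_pM2l//; move: dj; lra.
have der : derivable U t 1.
  apply/cvg_ex; exists (w t).
  suff -> : (fun h : R => h^-1 *: ((U \o shift t) (h *: 1) - U t)) =
      (fun h => h^-1 *: (U (h + t) - U t)) by [].
  by apply/funext => h /=; rewrite [h *: 1]mulr1.
by split => //; exact: cvg_lim key.
Unshelve. all: by end_near. Qed.

End AeDerivative.

(** * Projections and proximal normals *)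

Section Projections.
Context {R : realType} {E : normedModType R}.
Implicit Types (S : set E) (x y v : E).

Lemma projP S x y : Defs.proj S x y <-> S y /\ forall z, S z -> `|x - y| <= `|x - z|.
Proof.
split=> [[Sy xy]|[Sy xy]]; split=> //.
  move=> z Sz; rewrite -lee_fin xy -edist_norm.
  by apply: ereal_inf_lbound; exists z.
apply/eqP; rewrite eq_le; apply/andP; split.
  apply: le_ereal_inf_tmp => _ [z Sz <-].
  by rewrite edist_norm lee_fin xy.
by rewrite -edist_norm; apply: ereal_inf_lbound; exists y.
Qed.

(** Only the part of [S] in a closed ball around [x] that meets [S] matters. *)
Lemma proj_nonempty S x : S !=set0 -> ball_compact S -> exists y, Defs.proj S x y.
Proof.
move=> [c Sc] cS; pose rho := `|x - c| + 1.
have rho0 : 0 < rho by rewrite ltr_wpDl.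
have K0 : (closed_ball x rho `&` S) !=set0.
  by exists c; split => //; rewrite closed_ballE// /closed_ball_/= lerDl.
have [|y] := @compact_EVT_min E R (fun z => `|x - z|) _ K0 (cS x rho).
  apply: continuous_subspaceT => z; apply: cvg_norm.
  by apply: cvgB; [exact: cvg_cst|exact: cvg_id].
rewrite inE => -[_ Sy] ymin; exists y; apply/projP; split => // z Sz.
have [zr|zr] := leP `|x - z| rho.
  by apply: ymin; rewrite inE; split => //; rewrite closed_ballE.
apply: le_trans (ymin c _) _; first by rewrite inE; split => //;
  rewrite closed_ballE// /closed_ball_/= lerDl.
by rewrite (le_trans _ (ltW zr))// lerDl.
Qed.

Lemma hausdorff_dist_near S1 S2 (d : R) x : S1 !=set0 -> ball_compact S1 ->
  (hausdorff_dist S1 S2 <= d%:E)%E -> S2 x -> exists2 y, S1 y & `|x - y| <= d.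
Proof.
move=> S10 cS1 hd S2x; have [y [S1y xy]] := proj_nonempty x S10 cS1.
exists y => //; rewrite -lee_fin xy; apply: le_trans hd.
by rewrite /hausdorff_dist le_max; apply/orP; right; apply: ereal_sup_ubound; exists x.
Qed.

(** The empty ball of radius [r] contains the smaller tangent ball of radius
    [rho * `|v|]. Thus one [rho] serves all normals of norm at most [r / rho], which
    is the form that is stable under weak limits. *)
Lemma prox_regular_le S (r rho : R) x v : prox_regular r S -> S x ->
  normal_cone S x v -> 0 < rho -> rho * `|v| <= r ->
  forall y, S y -> rho * `|v| <= `|x + rho *: v - y|.
Proof.
move=> [_ pr] Sx Nv rho0 rv y Sy.
have [->|v0] := eqVneq v 0; first by rewrite normr0 mulr0.
have nv : 0 < `|v| by rewrite normr_gt0.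
have : ~ ball (x + (r / `|v|) *: v) r y.
  by move=> h; have := pr x v Sx Nv v0; rewrite -subset0 => /(_ y); apply.
rewrite -ball_normE/= => /negP; rewrite -leNgt => h.
have e1 : x + (r / `|v|) *: v - y = (x + rho *: v - y) + (r / `|v| - rho) *: v.
  by rewrite scalerBl [RHS]addrAC [X in _ = X - _]addrACA subrr addr0.
have rr : 0 <= r / `|v| - rho by rewrite subr_ge0 ler_pdivlMr.
have e2 : `|(r / `|v| - rho) *: v| = r - rho * `|v|.
  by rewrite normrZ ger0_norm// mulrBl divfK// gt_eqF.
have := ler_normD (x + rho *: v - y) ((r / `|v| - rho) *: v).
rewrite -e1 e2; lra.
Qed.

Lemma proximal_normal S (rho : R) x v : 0 < rho -> S x ->
  (forall y, S y -> `|rho *: v| <= `|x - y + rho *: v|) -> normal_cone S x v.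
Proof.
move=> rho0 Sx H; exists rho => //; apply/projP; split => // z Sz.
by rewrite addrAC subrr add0r addrAC H.
Qed.

End Projections.

(** * The catching-up scheme *)

Section StepIndex.
Context {R : realType}.
Notation mu := (@lebesgue_measure R).
Implicit Types (h t : R) (N i j : nat).

(** Capping at [N] keeps the range finite; it is inactive on [[0, h *+ N]]. *)
Definition step_index h N t : nat := minn (Num.truncn (t / h)) N.

Lemma step_indexP h N t : 0 < h -> 0 <= t -> t <= h *+ N ->
  h *+ step_index h N t <= t /\ t < h *+ (step_index h N t).+1.
Proof.
move=> h0 t0 tN; have th : 0 <= t / h by rewrite divr_ge0// ltW.
have tr : (Num.truncn (t / h) <= N)%N.
  rewrite -(@ler_nat R) (le_trans (andP (truncn_itv th)).1)//.
  by rewrite ler_pdivrMr// mulrC mulr_natr.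
rewrite /step_index (minn_idPl tr); have /andP[h1 h2] := truncn_itv th.
move: h1 h2; rewrite ler_pdivlMr// ltr_pdivrMr//.
by rewrite !(mulrC _ h) !mulr_natr.
Qed.

Lemma step_index_le h N t : (step_index h N t <= N)%N.
Proof. exact: geq_minr. Qed.

Lemma step_index_homo h N s t : 0 < h -> s <= t ->
  (step_index h N s <= step_index h N t)%N.
Proof.
move=> h0 st; rewrite leq_min geq_minr andbT (leq_trans (geq_minl _ _))//.
by apply: le_truncn; rewrite ler_wpM2r// invr_ge0 ltW.
Qed.

Lemma step_index_eq h N t i : 0 < h -> (i < N)%N -> h *+ i <= t -> t < h *+ i.+1 ->
  step_index h N t = i.
Proof.
move=> h0 iN it ti; rewrite /step_index (_ : Num.truncn _ = i).
  by apply/minn_idPl; exact: ltnW.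
apply: truncn_def; rewrite ler_pdivlMr// ltr_pdivrMr// !(mulrC _ h) !mulr_natr.
by rewrite it.
Qed.

Lemma simple_step_index (V : normedModType R) h N (a : nat -> V) : 0 < h ->
  simple (fun t => a (step_index h N t)).
Proof.
move=> h0; have fin : finite_set (range (fun t => a (step_index h N t))).
  apply: (@sub_finite_set _ _ (a @` `I_N.+1)).
    move=> _ [t _ <-]; exists (step_index h N t) => //=.
    by rewrite ltnS step_index_le.
  by apply: finite_image; exact: finite_II.
split=> // v.
have m j : measurable ((fun t => (step_index h N t)%:R : R) @^-1` [set j%:R]).
  rewrite -[X in measurable X]setTI.
  have : measurable_fun setT (fun t => (step_index h N t)%:R : R).
    apply: nondecreasing_measurable => // s t st.
    by rewrite ler_nat step_index_homo.
  by apply => //; exact: measurable_set1.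
have -> : (fun t => a (step_index h N t)) @^-1` [set v] =
   \bigcup_(j in [set j | a j = v]) ((fun t => (step_index h N t)%:R : R) @^-1` [set j%:R]).
  apply/seteqP; split => [t /= tv|t [j /= jv /eqP]].
    by exists (step_index h N t).
  by rewrite eqr_nat => /eqP ->.
exact: bigcup_measurable.
Qed.

Lemma integrable_step (a b : R) h N (psi : nat -> R) : 0 < h ->
  mu.-integrable `[a, b] (EFin \o (fun t => psi (step_index h N t))).
Proof.
move=> h0; apply: (@bounded_integrable _ _ _ (\sum_(i < N.+1) `|psi i|)) => //.
- by rewrite /= lebesgue_measure_itv/=; case: ifP => _; rewrite -?EFinB ltry.
- apply: (@simple_measurable R R^o idfun (fun t => psi (step_index h N t))).
  exact: (@simple_step_index R^o).
- move=> t _; have iN := step_index_le h N t.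
  have iN1 : (step_index h N t < N.+1)%N by [].
  by rewrite (bigD1 (Ordinal iN1))//= lerDl sumr_ge0.
Qed.

(** The integral is the broken line through the nodes [(h *+ i, a i)], and the step
    function through the same nodes differs from it by at most one increment. *)
Lemma integral_step_le h N (a psi : nat -> R) (M : R) t : 0 < h ->
  (forall i, (i <= N)%N -> h * psi i = a i.+1 - a i) ->
  (forall i, (i <= N)%N -> `|a i.+1 - a i| <= M) ->
  0 <= t -> t <= h *+ N ->
  `| a (step_index h N t) - a 0%N - \int[mu]_(s in `[0, t]) psi (step_index h N s) | <= M.
Proof.
move=> h0 psiE aM t0 tN.
pose F t := \int[mu]_(s in `[0, t]) psi (step_index h N s).
have muE (x y : R) : x <= y -> fine (mu `]x, y]) = y - x.
  move=> xy; rewrite lebesgue_measure_itv/= lte_fin; case: ltP => //= yx.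
  by apply/eqP; rewrite eq_sym subr_eq0 eq_le yx xy.
have split x y : 0 <= x -> x <= y ->
    F y = F x + \int[mu]_(s in `]x, y]) psi (step_index h N s).
  move=> x0 xy; rewrite -(@Rintegral_itvB _ _ (BLeft 0) (BRight y) x) ?bnd_simp//.
    by rewrite addrC subrK.
  exact: integrable_step.
have part i y : (i < N)%N -> h *+ i <= y -> y <= h *+ i.+1 ->
    F y = F (h *+ i) + (y - h *+ i) * psi i.
  move=> iN iy yi; have hi0 : 0 <= h *+ i by rewrite mulrn_wge0// ltW.
  rewrite (split _ _ hi0 iy); congr (_ + _).
  have int b1 b2 : mu.-integrable [set` Interval (BSide b1 (h *+ i)) (BSide b2 y)]
      (EFin \o (fun t => psi (step_index h N t))).
    apply: (@integrableS _ _ _ mu `[h *+ i, y]) => //; last exact: integrable_step.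
    move=> u /=; rewrite !in_itv/= => /andP[u1 u2].
    by rewrite (lteifW u1) (lteifW u2).
  rewrite -Rintegral_itv_bndo_bndc; last exact: int.
  rewrite (@eq_Rintegral _ _ _ _ _ (cst (psi i))); last first.
    move=> s; rewrite inE/= in_itv/= => /andP[s1 s2].
    by rewrite (@step_index_eq _ _ _ i)// ?(ltW s1)// (lt_le_trans s2).
  rewrite Rintegral_itv_bndo_bndc; last first.
    apply: (@integrableS _ _ _ mu `[h *+ i, y]) => //.
      by move=> u /=; rewrite !in_itv/= => /andP[u1 u2]; rewrite !ltW.
    apply: (@bounded_integrable _ _ _ `|psi i|) => //.
    by rewrite /= lebesgue_measure_itv/=; case: ifP => _; rewrite -?EFinB ltry.
  by rewrite Rintegral_cst// muE// mulrC.
have node i : (i <= N)%N -> F (h *+ i) = a i - a 0%N.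
  elim: i => [_|i IH iN].
    by rewrite mulr0n subrr /F set_itv1 Rintegral_set1.
  rewrite (part i)//; last by rewrite ler_wpMn2l// ltW.
  rewrite IH 1?ltnW// mulrSr [h *+ i + h]addrC addrK psiE 1?ltnW//; ring.
have [h1 h2] := step_indexP h0 t0 tN.
set i := step_index h N t in h1 h2 *.
have [iN|iN] := ltnP i N.
  rewrite -/(F t) (part i)// ?(ltW h2)// node 1?ltnW//.
  rewrite opprD addrA subrr add0r normrN normrM.
  have := aM i (ltnW iN); rewrite -psiE 1?ltnW// normrM; apply: le_trans.
  rewrite ler_wpM2r// (gtr0_norm h0) ger0_norm ?subr_ge0// lerBlDl.
  by rewrite -mulrSr ltW.
have iE : i = N by apply/eqP; rewrite eqn_leq iN step_index_le.
have tE : t = h *+ N by apply/eqP; rewrite eq_le tN -iE h1.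
rewrite -/(F t) tE node// iE subrr normr0.
exact: le_trans (aM N (leqnn N)).
Qed.

End StepIndex.

Section CatchingUp.
Context {R : realType} {E : normedModType R}.
Notation mu := (@lebesgue_measure R).
Variables (T r k L : R) (f : E -> E) (C : R -> set E) (u0 : E).

(** [a] follows the positions of the scheme and [x] the normals. [K] bounds everything
    uniformly, [e] is the error of discretization. In [approx_proximal], the
    factor [r / K] brings a normal of norm at most [K] to norm at most [r], the
    radius of prox-regularity. The normal belongs to the set at the end of the step,
    while [c] is in the set at time [t]; [e] covers the difference. *)
Record approximate_solution (K e : R) (a x : R -> E) : Prop := ApproximateSolution {
  approx_simple : simple a;
  approx_normal_simple : simple x;
  approx_bound : forall t, 0 <= t <= T -> `|a t| <= K;
  approx_normal_bound : forall t, 0 <= t <= T -> `|x t| <= K;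
  approx_start : a 0 = u0;
  approx_near : forall t, 0 <= t <= T -> exists2 c, C t c & `|a t - c| <= e;
  approx_lipschitz : forall s t, 0 <= s <= T -> 0 <= t <= T ->
    `|a t - a s| <= K * `|t - s| + e;
  approx_proximal : forall t c, 0 <= t <= T -> C t c ->
    `|(r / K) *: x t| <= `|a t - c + (r / K) *: x t| + e;
  approx_integral : forall (phi : dual E) t, 0 <= t <= T ->
    `|phi (a t - u0) - \int[mu]_(s in `[0, t]) phi (f (a s) - x s)|
      <= dual_norm phi * e }.

Hypotheses (T0 : 0 < T) (r0 : 0 < r) (k0 : 0 < k) (L0 : 0 < L).
Hypothesis f_growth : forall x, `|f x| <= L * (1 + `|x|).
Hypothesis HC : forall t, [/\ C t !=set0, ball_compact (C t) & prox_regular r (C t)].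
Hypothesis C_lip : forall s t x, C s x -> exists2 y, C t y & `|x - y| <= k * `|t - s|.
Hypothesis Cu0 : C 0 u0.

Lemma catching_up (h : R) : exists u : nat -> E, u 0%N = u0 /\
  forall i, Defs.proj (C (h *+ i.+1)) (u i + h *: f (u i)) (u i.+1).
Proof.
have /choice[P HP] : forall q : R * E, exists y, Defs.proj (C q.1) q.2 y.
  by move=> -[t x] /=; have [h1 h2 _] := HC t; exact: proj_nonempty.
exists (nat_rect (fun=> E) u0 (fun i x => P (h *+ i.+1, x + h *: f x))).
split => // i; exact: (HP (h *+ i.+1, _)).
Qed.

Section Step.
Variables (h : R) (u : nat -> E).
Hypotheses (h0 : 0 < h) (u_start : u 0%N = u0)
  (u_proj : forall i, Defs.proj (C (h *+ i.+1)) (u i + h *: f (u i)) (u i.+1)).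

Let v i := h^-1 *: (u i + h *: f (u i) - u i.+1).
Let c := k + 2 * L.

Lemma catching_up_in i : C (h *+ i) (u i).
Proof. by case: i => [|i]; rewrite ?mulr0n ?u_start//; have [] := u_proj i. Qed.

Lemma catching_up_normal i : normal_cone (C (h *+ i.+1)) (u i.+1) (v i).
Proof.
exists h => //; rewrite /v scalerA mulfV ?gt_eqF// scale1r addrC subrK.
exact: u_proj.
Qed.

(** [u i] itself is within [k * h] of the next set, which bounds the distance that
    the projection has to travel. *)
Lemma catching_up_normal_le i : `|v i| <= k + `|f (u i)|.
Proof.
rewrite /v normrZ normfV (gtr0_norm h0) ler_pdivrMl//.
have [y Cy uy] := C_lip (h *+ i.+1) (catching_up_in i).
have [_ /(_ y Cy)] := (projP _ _ _).1 (u_proj i) => /le_trans; apply.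
rewrite addrAC (le_trans (ler_normD _ _))// normrZ (gtr0_norm h0) mulrDr lerD2r.
by rewrite (le_trans uy)// mulrS addrK (gtr0_norm h0) mulrC.
Qed.

Lemma catching_up_slope i : h *: (f (u i) - v i) = u i.+1 - u i.
Proof.
rewrite /v scalerBr scalerA mulfV ?gt_eqF// scale1r opprB addrCA; congr (_ + _).
by rewrite opprD addrCA subrr addr0.
Qed.

Lemma catching_up_step_le i : `|u i.+1 - u i| <= h * (c * (1 + `|u i|)).
Proof.
rewrite -catching_up_slope normrZ (gtr0_norm h0) ler_pM2l//.
have := catching_up_normal_le i; have := ler_normB (f (u i)) (v i).
have := f_growth (u i); have := mulr_ge0 (ltW k0) (normr_ge0 (u i)); rewrite /c.
lra.
Qed.

(** Discrete Gronwall inequality. *)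
Lemma catching_up_bound i : 1 + `|u i| <= expR (c * (h *+ i)) * (1 + `|u0|).
Proof.
elim: i => [|i IH]; first by rewrite mulr0n mulr0 expR0 mul1r u_start.
have c0 : 0 <= c by rewrite addr_ge0 ?mulr_ge0 ?ltW.
apply: (@le_trans _ _ ((1 + c * h) * (1 + `|u i|))).
  have := catching_up_step_le i; have := ler_normD (u i.+1 - u i) (u i).
  rewrite subrK; lra.
rewrite mulrS (mulrDr c) expRD -mulrA ler_pM ?addr_ge0 ?mulr_ge0 ?(ltW h0)//.
exact: expR_ge1Dx.
Qed.

End Step.

Let c := k + 2 * L.
Let M0 := expR (c * T) * (1 + `|u0|).
Let K := (c + 1) * M0.

Let c0 : 0 < c. Proof. by rewrite addr_gt0 ?mulr_gt0. Qed.

Let M01 : 1 <= M0.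
Proof.
rewrite /M0 -[leLHS]mulr1 ler_pM ?lerDl//.
by rewrite -expR0 ler_expR mulr_ge0 ?ltW.
Qed.

Let M00 : 0 <= M0. Proof. exact: le_trans M01. Qed.
Let M0K : M0 <= K. Proof. by rewrite ler_peMl// lerDr ltW. Qed.
Let cM0K : c * M0 <= K. Proof. by rewrite ler_wpM2r// lerDl. Qed.
Let kK : k <= K.
Proof.
rewrite (le_trans _ cM0K)// (@le_trans _ _ c)//.
  by rewrite lerDl mulr_ge0// ltW.
by rewrite ler_peMr// ltW.
Qed.
Let K0 : 0 < K. Proof. exact: lt_le_trans kK. Qed.

Lemma catching_up_approximation n :
  exists a x, approximate_solution K (2 * K * (T / n.+1%:R)) a x.
Proof.
set h := T / n.+1%:R; set e := 2 * K * h.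
have h0 : 0 < h by rewrite divr_gt0.
have hN : h *+ n.+1 = T by rewrite /h -(mulr_natr (T / _)) divfK.
have [u [ustart uproj]] := catching_up h.
pose v i := h^-1 *: (u i + h *: f (u i) - u i.+1).
pose N := n.+1; pose J := step_index h N.
have uM i : (i <= N)%N -> 1 + `|u i| <= M0.
  move=> iN; rewrite (le_trans (catching_up_bound h0 ustart uproj i))//.
  rewrite ler_wpM2r ?addr_ge0// ler_expR ler_wpM2l ?(ltW c0)// -hN.
  by rewrite ler_wpMn2l// ltW.
have uK i : (i <= N)%N -> `|u i| <= K.
  by move=> /uM h1; rewrite (le_trans _ M0K)//; lra.
have stepK i : (i <= N)%N -> `|u i.+1 - u i| <= K * h.
  move=> iN; rewrite (le_trans (catching_up_step_le h0 ustart uproj i))//.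
  rewrite mulrC ler_pM2r// (le_trans _ cM0K)// ler_pM2l//; exact: uM.
have vK i : (i <= N)%N -> `|v i| <= K.
  move=> iN; rewrite (le_trans (catching_up_normal_le h0 ustart uproj i))//.
  rewrite (le_trans _ cM0K)//.
  have h1 : L * (1 + `|u i|) <= L * M0 by rewrite ler_pM2l// uM.
  have h2 : k <= k * M0 by rewrite ler_peMr// ltW.
  by have := f_growth (u i); have := mulr_ge0 (ltW L0) M00; rewrite /c; lra.
have JN t : (J t <= N)%N := step_index_le h N t.
have JP t : 0 <= t <= T -> h *+ J t <= t /\ t < h *+ (J t).+1.
  by move=> /andP[t0 tT]; apply: step_indexP => //; rewrite hN.
have hh t : 0 <= t <= T -> `|t - h *+ J t| <= h.
  move=> /JP[h1 h2]; rewrite ger0_norm ?subr_ge0// lerBlDl -mulrSr; exact: ltW.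
have hS t : 0 <= t <= T -> `|t - h *+ (J t).+1| <= h.
  move=> /JP[h1 h2]; rewrite ler0_norm ?subr_le0 ?(ltW h2)//.
  by rewrite opprB lerBlDr mulrS lerD2l.
have Kh0 : 0 <= K * h by rewrite mulr_ge0 ?ltW.
have khKh : k * h <= K * h by rewrite ler_wpM2r// ltW.
have eE : e = K * h + K * h by rewrite /e; ring.
exists (u \o J), (v \o J); split.
- exact: simple_step_index.
- exact: simple_step_index.
- by move=> t tT; exact: uK.
- by move=> t tT; exact: vK.
- rewrite /= /J /step_index mul0r truncn0 min0n//.
- move=> t tT; have [y Cy uy] := C_lip t (catching_up_in ustart uproj (J t)).
  exists y => //; rewrite (le_trans uy)//.
  apply: (@le_trans _ _ (k * h)); first by rewrite ler_pM2l//; exact: hh.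
  by rewrite eE; lra.
- have lip s t : s <= t -> 0 <= s <= T -> 0 <= t <= T ->
      `|u (J t) - u (J s)| <= K * `|t - s| + e.
    move=> st sT tT; have [s1 s2] := JP s sT; have [t1 t2] := JP t tT.
    have JJ : (J s <= J t)%N by exact: step_index_homo.
    have tele m : (J s + m <= N)%N -> `|u (J s + m)%N - u (J s)| <= K * (h *+ m).
      elim: m => [_|m IH mN]; first by rewrite addn0 subrr normr0 mulr0n mulr0.
      rewrite addnS in mN *; have -> : u (J s + m).+1 - u (J s) =
        (u (J s + m).+1 - u (J s + m)%N) + (u (J s + m)%N - u (J s)).
        by rewrite addrA subrK.
      rewrite (le_trans (ler_normD _ _))// mulrS mulrDr lerD//.
        by apply: stepK; exact: ltnW.
      by apply: IH; exact: ltnW.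
    have := tele (J t - J s)%N; rewrite subnKC// => /(_ (JN t)) h1.
    rewrite (le_trans h1)// ger0_norm ?subr_ge0// mulrnBr//.
    rewrite eE; move: s2; rewrite mulrS => s2.
    have : h *+ J t - h *+ J s <= t - s + h by lra.
    by move=> /(ler_wpM2l (ltW K0)); lra.
  move=> s t sT tT /=; have [st|/ltW ts] := leP s t; first exact: lip.
  by rewrite distrC (distrC t); exact: lip.
- move=> t y tT Cy /=; have [z Cz yz] := C_lip (h *+ (J t).+1) Cy.
  have [_ _ prox] := HC (h *+ (J t).+1).
  have rK : 0 < r / K by rewrite divr_gt0.
  have := prox_regular_le prox (catching_up_in ustart uproj (J t).+1)
    (catching_up_normal h0 uproj (J t)) rK _ Cz.
  rewrite -/(v (J t)) => H.
  have {}H := H _; rewrite normrZ (gtr0_norm rK).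
  rewrite (le_trans (H _))//.
    by rewrite mulrAC ler_pdivrMr// ler_pM2l// vK.
  have -> : u (J t).+1 + (r / K) *: v (J t) - z =
     (u (J t) - y + (r / K) *: v (J t)) + ((u (J t).+1 - u (J t)) + (y - z)).
    by rewrite [RHS]addrAC [LHS]addrAC; congr (_ + _); rewrite addrCA !subrKA.
  rewrite (le_trans (ler_normD _ _))// lerD2l (le_trans (ler_normD _ _))// eE.
  rewrite lerD ?stepK// (le_trans yz)// (le_trans _ khKh)// ler_pM2l// distrC.
  exact: hS.
- move=> phi t /andP[t0 tT].
  have step i : (i <= N)%N -> h * phi (f (u i) - v i) = phi (u i.+1) - phi (u i).
    move=> iN; rewrite -dual_scale -linearB; congr (phi _).
    exact: catching_up_slope.
  have tN : t <= h *+ N by rewrite hN.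
  have := @integral_step_le _ h N (fun i => phi (u i)) (fun i => phi (f (u i) - v i))
    (dual_norm phi * (K * h)) t h0 step _ t0 tN.
  rewrite -ustart linearB => H; apply: le_trans (H _) _.
    move=> i iN; rewrite -linearB (le_trans (dual_normP _ _))//.
    by rewrite ler_wpM2l ?dual_norm_ge0// stepK.
  by rewrite ler_wpM2l ?dual_norm_ge0// eE lerDl.
Qed.

Lemma catching_up_approximations : exists2 K : R, 0 < K & forall n,
  exists a x, approximate_solution K (2 * K * (T / n.+1%:R)) a x.
Proof. by exists K => // n; exact: catching_up_approximation. Qed.

End CatchingUp.

(** * Compactness of the approximations *)

(** Tychonoff's theorem, in the place of a diagonal extraction, gives a cluster point
    for all times at once; a neighbourhood in the product topology sees finitely
    many times. *)
Lemma pointwise_cluster (R : realType) (E : normedModType R) (X : R -> set E)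
    (c : nat -> R -> E) : (forall t, compact (X t)) -> (forall n t, X t (c n t)) ->
  exists U : R -> E, (forall t, X t (U t)) /\
    forall (s : seq R) (e : R) (N : nat), 0 < e ->
      exists2 n, (N <= n)%N & forall t, t \in s -> `|U t - c n t| < e.
Proof.
move=> cX Xc.
have := @tychonoff R (fun=> E) X cX.
move=> /(_ ((c : nat -> prod_topology (fun _ : R => E)) @ \oo)) [].
  by exists 0%N => // n _ t; exact: Xc.
move=> U [XU clU]; exists U; split => // s e N e0.
pose PT : topologicalType := prod_topology (fun _ : R => E).
have nU : nbhs (U : PT) [set g : PT | forall t, t \in s -> `|U t - g t| < e].
  have FU : Filter (nbhs (U : PT)) := nbhs_filter _.
  elim: s => [|t s IH].
    by apply: (@filterS _ _ FU setT) => [g _ t|]; [rewrite in_nil|exact: filterT].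
  have := @proj_continuous R (fun=> E) t U (ball (U t) e) (nbhsx_ballx _ _ e0).
  move=> /(@filterI _ _ FU _ _ IH); apply: (@filterS _ _ FU) => g [/= gs gt] z.
  rewrite inE => /predU1P[->|/gs//].
  by move: gt; rewrite /= -ball_normE.
have tail : ((c : nat -> prod_topology (fun _ : R => E)) @ \oo)
    [set g | exists2 n, (N <= n)%N & g = c n].
  by exists N => // n /= Nn; exists n.
by have [g [[n Nn ->] gs]] := clU _ _ tail nU; exists n.
Qed.

Section Limit.
Context {R : realType} {E : normedModType R}.
Variables (T r : R) (f : E -> E) (C : R -> set E) (u0 : E).
Variables (K : R) (e : nat -> R) (a x : nat -> R -> E).
Hypotheses (T0 : 0 < T) (K0 : 0 < K) (cC : forall t, ball_compact (C t)).
Hypotheses (e_ge0 : forall n, 0 <= e n) (e_cvg : e n @[n --> \oo] --> (0 : R)).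
Hypothesis approx : forall n, approximate_solution T r f C u0 K (e n) (a n) (x n).

Let e_small (eta : R) : 0 < eta -> exists N, forall n, (N <= n)%N -> e n <= eta.
Proof.
move=> eta0; have /cvgrPdist_le/(_ _ eta0)[N _ Ne] := e_cvg; exists N => n Nn.
by have := Ne n Nn; rewrite /= sub0r normrN ger0_norm.
Qed.

(** A pointwise cluster point of the projections of the approximations on [C t]
    is Lipschitz, so closeness on a fine finite grid is closeness everywhere. *)
Lemma uniform_subsequence : exists (U : R -> E) (sigma : nat -> nat),
  [/\ forall t, 0 <= t <= T -> C t (U t),
      forall s t, 0 <= s <= T -> 0 <= t <= T -> `|U t - U s| <= K * `|t - s|,
      U 0 = u0, {homo sigma : m n / (m < n)%N} &
      forall m t, 0 <= t <= T -> `|U t - a (sigma m) t| <= m.+1%:R^-1].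
Proof.
have [N1 eN1] := e_small ltr01.
have /choice[c cP] : forall q : nat * R, exists c, 0 <= q.2 <= T ->
    C q.2 c /\ `|a q.1 q.2 - c| <= e q.1.
  move=> [n t] /=; case: (boolP (0 <= t <= T)) => tT; last by exists 0.
  by have [c Cc ac] := approx_near (approx n) tT; exists c.
pose cc n t : E := if 0 <= t <= T then c ((N1 + n)%N, t) else 0.
pose X t : set E := if 0 <= t <= T then closed_ball 0 (K + 1) `&` C t else [set 0].
have cX t : compact (X t) by rewrite /X; case: ifP => _; [exact: cC|exact: compact_set1].
have ccP n t : 0 <= t <= T -> C t (cc n t) /\ `|a (N1 + n)%N t - cc n t| <= e (N1 + n)%N.
  by move=> tT; rewrite /cc tT; exact: (cP (_, _)).
have Xcc n t : X t (cc n t).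
  rewrite /X; case: ifP => tT; last by rewrite /cc tT.
  have [Ct act] := ccP n t tT; split=> //.
  rewrite closed_ballE ?addr_gt0// /closed_ball_/= sub0r normrN.
  have -> : cc n t = a (N1 + n)%N t - (a (N1 + n)%N t - cc n t).
    by rewrite opprB addrCA subrr addr0.
  rewrite (le_trans (ler_normB _ _))// lerD ?(approx_bound (approx _))//.
  by rewrite (le_trans act)// eN1// leq_addr.
have [U [XU clU]] := pointwise_cluster cX Xcc.
have CU t : 0 <= t <= T -> C t (U t) by move=> tT; have := XU t; rewrite /X tT => -[].
(* A cluster point is approached along arbitrarily large indices, but the index
   depends on the finite set of times. *)
have near_grid (s : seq R) (eta : R) N : 0 < eta ->
    exists2 n, (N <= n)%N & e n <= eta /\
      forall t, t \in s -> 0 <= t <= T -> `|U t - a n t| <= eta.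
  move=> eta0; have eta2 : 0 < eta / 2 by rewrite divr_gt0.
  have [N2 eN2] := e_small eta2.
  have [n Nn ns] := clU s _ (N + N2)%N eta2.
  have en : e (N1 + n)%N <= eta / 2.
    by apply: eN2; rewrite (leq_trans (leq_addl N N2))// (leq_trans Nn)// leq_addl.
  exists (N1 + n)%N.
    by rewrite (leq_trans (leq_addr N2 N))// (leq_trans Nn)// leq_addl.
  split; first by rewrite (le_trans en)// ler_pdivrMr// ler_peMr ?(ltW eta0)// ler1n.
  move=> t ts tT; have [_ act] := ccP n t tT; have Uc := ns t ts.
  rewrite distrC -(subrKA (cc n t)) (le_trans (ler_normD _ _))// (splitr eta).
  by rewrite lerD// ?(le_trans act)// distrC ltW.
have U_lip s t : 0 <= s <= T -> 0 <= t <= T -> `|U t - U s| <= K * `|t - s|.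
  move=> sT tT; apply/ler_addgt0Pr => eta eta0.
  have eta3 : 0 < eta / 3 by rewrite divr_gt0.
  have [n _ [en ns]] := near_grid [:: s; t] _ 0%N eta3.
  have tst : t \in [:: s; t] by rewrite !inE eqxx orbT.
  have ss := ns s (mem_head _ _) sT; have ts := ns t tst tT.
  have al := approx_lipschitz (approx n) sT tT.
  rewrite -(subrKA (a n t)) -(subrKA (a n s) (a n t)).
  rewrite (le_trans (ler_normD _ _))//.
  rewrite (le_trans (lerD ts (ler_normD _ _)))// [`|a n s - _|]distrC.
  by move: al ss en; lra.
have U_start : U 0 = u0.
  apply/eqP; rewrite -subr_eq0 -normr_le0; apply/ler_addgt0Pr => eta eta0.
  have [n _ [_ ns]] := near_grid [:: 0] _ 0%N eta0.
  have zT : 0 <= (0 : R) <= T by rewrite lexx ltW.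
  by have := ns 0 (mem_head _ _) zT; rewrite (approx_start (approx n)) add0r.
have uniform (eta : R) N : 0 < eta -> exists2 n, (N <= n)%N &
    forall t, 0 <= t <= T -> `|U t - a n t| <= eta.
  move=> eta0; have eta5 : 0 < eta / 5 by rewrite divr_gt0.
  have KT : 0 < K * T by rewrite mulr_gt0.
  have [Q _ /(_ Q (leqnn Q)) Qs] := near_infty_natSinv_lt (PosNum (divr_gt0 eta5 KT)).
  rewrite /= ltr_pdivlMr// in Qs.
  pose h := T / Q.+1%:R.
  have h0 : 0 < h by rewrite divr_gt0.
  have hQ : h *+ Q.+1 = T by rewrite /h -(mulr_natr (T / _)) divfK.
  have Kh : K * h <= eta / 5.
    by rewrite /h mulrA mulrC ltW.
  have [n Nn [en ns]] := near_grid [seq h *+ i | i <- iota 0 Q.+2] _ N eta5.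
  exists n => // t tT; have /andP[t0 tle] := tT.
  rewrite -hQ in tle; have [j1 j2] := step_indexP h0 t0 tle.
  set j := step_index h Q.+1 t in j1 j2.
  have jQ : (j < Q.+2)%N by rewrite ltnS step_index_le.
  have sT : 0 <= h *+ j <= T.
    by rewrite mulrn_wge0 ?(ltW h0)//= -hQ (le_trans j1).
  have ts : `|t - h *+ j| <= h by rewrite ger0_norm ?subr_ge0// lerBlDl -mulrSr ltW.
  have Kts : K * `|t - h *+ j| <= eta / 5 by rewrite (le_trans _ Kh)// ler_pM2l.
  have sgrid : h *+ j \in [seq h *+ i | i <- iota 0 Q.+2].
    by apply: map_f; rewrite mem_iota.
  have e1 := U_lip _ _ sT tT; have e2 := ns _ sgrid sT.
  have e3 := approx_lipschitz (approx n) sT tT.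
  rewrite -(subrKA (U (h *+ j))) -(subrKA (a n (h *+ j)) (U (h *+ j))).
  rewrite (le_trans (ler_normD _ _))//.
  rewrite (le_trans (lerD e1 (ler_normD _ _)))// [`|a n (h *+ j) - _|]distrC.
  by move: Kts e2 e3 en; lra.
have /choice[g gP] : forall q : nat * nat, exists n, (q.2 <= n)%N /\
    forall t, 0 <= t <= T -> `|U t - a n t| <= q.1.+1%:R^-1.
  move=> [m N]; have [|n Nn nU] := uniform m.+1%:R^-1 N; first by rewrite invr_gt0.
  by exists n.
pose sigma := nat_rect (fun=> nat) (g (0%N, 0%N)) (fun m s => g (m.+1, s.+1)).
exists U, sigma; split => //.
  apply: homo_ltn => [|m]; first exact: ltn_trans.
  by rewrite /sigma/=; have [] := gP (m.+1, (sigma m).+1).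
by case=> [|m] t tT; [have [_] := gP (0%N, 0%N)|have [_] := gP (m.+1, (sigma m).+1)]; apply.
Qed.

End Limit.

(** * Passage to the limit *)

Lemma lipschitz_abs_continuous (R : realType) (E : normedModType R) (a b K : R)
    (u : R -> E) : 0 < K ->
  (forall s t, a <= s <= b -> a <= t <= b -> `|u t - u s| <= K * `|t - s|) ->
  abs_continuous a b u.
Proof.
move=> K0 lip e e0; exists (e / K); first exact: divr_gt0.
move=> n s t st _; rewrite ltr_pdivlMr// mulrC => lt_e; apply: le_lt_trans lt_e.
rewrite mulr_sumr; apply: ler_sum => i _; have [h1 h2 h3] := st i.
rewrite (le_trans (lip _ _ _ _))//.
- by rewrite h1 (le_trans h2 h3).
- by rewrite h3 (le_trans h1 h2).
- by rewrite ger0_norm// subr_ge0.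
Qed.

(** The distance from [xi] to [C t] is [k]-Lipschitz in [t], since [C] is. *)
Lemma measurable_distance (R : realType) (E : normedModType R) (C : R -> set E)
    (k : R) (xi : E) (P : R -> E) :
  (forall s t x, C s x -> exists2 y, C t y & `|x - y| <= k * `|t - s|) ->
  (forall t, Defs.proj (C t) xi (P t)) ->
  measurable_fun setT (fun t => `|xi - P t|).
Proof.
move=> C_lip PP.
have le s t : `|xi - P t| <= `|xi - P s| + k * `|t - s|.
  have [CP _] := (projP _ _ _).1 (PP s); have [y Cy Py] := C_lip s t _ CP.
  have [_ /(_ y Cy)] := (projP _ _ _).1 (PP t) => /le_trans; apply.
  by rewrite -(subrKA (P s)) (le_trans (ler_normD _ _))// lerD2l.
apply: continuous_measurable_fun => t; apply/cvgrPdist_le => e e0.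
have k1 : 0 < `|k| + 1 by rewrite ltr_wpDl.
have /cvgrPdist_lt/(_ _ (divr_gt0 e0 k1)) : s @[s --> t] --> t by exact: cvg_id.
apply: filterS => s; rewrite ltr_pdivlMr// => st.
have kst : k * `|t - s| <= e.
  rewrite (le_trans _ (ltW st))// mulrC ler_wpM2l//.
  by rewrite (le_trans (ler_norm _))// lerDl.
rewrite ler_norml; have := le s t; have := le t s; rewrite (distrC s).
by move: kst => *; apply/andP; split; lra.
Qed.

Section Solution.
Context {R : realType} {E : normedModType R}.
Notation mu := (@lebesgue_measure R).
Variables (T p r k L : R) (f : E -> E) (C : R -> set E) (u0 : E).
Hypotheses (T0 : 0 < T) (r0 : 0 < r) (k0 : 0 < k) (L0 : 0 < L) (p2 : 2 <= p).
Hypotheses (sepE : separable E) (us : uniformly_smooth E)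
  (swc : smoothly_weakly_compact `[0, T] E p).
Hypotheses (f_cont : continuous f) (f_growth : forall x, `|f x| <= L * (1 + `|x|)).
Hypothesis HC : forall t, [/\ C t !=set0, ball_compact (C t) & prox_regular r (C t)].
Hypothesis C_lip : forall s t x, C s x -> exists2 y, C t y & `|x - y| <= k * `|t - s|.
Hypothesis Cu0 : C 0 u0.

Let I : set R := `[0, T].
Let mI : measurable I. Proof. exact: measurable_itv. Qed.
Let Ioo : (mu I < +oo)%E.
Proof. by rewrite /I lebesgue_measure_itv/=; case: ifP => _; rewrite -?EFinB ltry. Qed.

Section Limit.
Variables (K : R) (e : nat -> R) (a x : nat -> R -> E) (U y : R -> E).
Hypotheses (K0 : 0 < K) (e_ge0 : forall n, 0 <= e n) (e_cvg : e n @[n --> \oo] --> (0 : R)).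
Hypothesis approx : forall n, approximate_solution T r f C u0 K (e n) (a n) (x n).
Hypothesis aU : forall n t, 0 <= t <= T -> `|U t - a n t| <= n.+1%:R^-1.
Hypothesis CU : forall t, 0 <= t <= T -> C t (U t).
Hypothesis U_start : U 0 = u0.
Hypothesis y_Linfty : in_Linfty I y.
Hypothesis x_weak : forall g : R -> dual E, in_L1 I g ->
  \int[mu]_(t in I) (g t (x n t)) @[n --> \oo] --> \int[mu]_(t in I) (g t (y t)).
Hypothesis x_smooth : forall (z : R -> E) (phi : R -> R),
  in_Linfty I z -> mu.-integrable I (EFin \o phi) ->
  \int[mu]_(t in I) (Jp_increment p (z t) (x n t) * phi t) @[n --> \oo] -->
  \int[mu]_(t in I) (Jp_increment p (z t) (y t) * phi t).

Let itvP t : I t -> 0 <= t <= T. Proof. by rewrite /I/= in_itv. Qed.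

Let harm : (n.+1%:R^-1 : R) @[n --> \oo] --> (0 : R).
Proof. exact: cvg_harmonic. Qed.

Let a_cvg t : 0 <= t <= T -> a n t @[n --> \oo] --> U t.
Proof.
move=> tT; apply/cvgrPdist_le => eta eta0.
have /cvgrPdist_le/(_ _ eta0) := harm; apply: filterS => n.
rewrite sub0r normrN ger0_norm// => h; exact: le_trans (aU n tT) h.
Qed.

Let U_meas : strongly_measurable I U.
Proof.
exists a; split; first by move=> n; exact: (approx_simple (approx n)).
by move=> t It; exact/a_cvg/itvP.
Qed.

Let x_meas n : strongly_measurable I (x n).
Proof. exact/strongly_measurable_simple/(approx_normal_simple (approx n)). Qed.

Let x_bound n t : I t -> `|x n t| <= K.
Proof. by move=> It; exact: (approx_normal_bound (approx n) (itvP It)). Qed.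

Let U_bound t : I t -> `|U t| <= K + 1.
Proof.
move=> /itvP tT; rewrite -(subrK (a 0%N t) (U t)) addrC (le_trans (ler_normD _ _))//.
rewrite lerD ?(approx_bound (approx _))//.
by rewrite (le_trans (aU 0%N tT))// invr1.
Qed.

Let w t := f (U t) - y t.

Let w_meas : strongly_measurable I w.
Proof.
have [my _] := y_Linfty; apply: (strongly_measurable_add (f := f \o U) (g := fun t => - y t)).
  exact: strongly_measurable_comp.
by apply: (strongly_measurable_comp (h := -%R)) => // v; apply: cvgN; exact: cvg_id.
Qed.

Let w_int : mu.-integrable I (EFin \o (fun t => `|w t|)).
Proof.
have [_ [My yM]] := y_Linfty.
apply: (@ess_bounded_integrable _ _ _ (L * (1 + (K + 1)) + My)) => //.
  exact: (measurable_norm_strongly w_meas).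
apply: ae_imply yM => t yt It; rewrite normr_id (le_trans (ler_normB _ _))//.
rewrite lerD ?yt// (le_trans (f_growth _))// ler_pM2l// lerD2l; exact: U_bound.
Qed.

(** The positions converge pointwise and boundedly, so dominated convergence applies
    to [phi (f (a n))]; the normals are tested against [phi] times the indicator
    of [[0, t]], an element of [L1]. *)
Lemma limit_integral (phi : dual E) (t : R) : 0 <= t <= T ->
  phi (U t - U 0) = \int[mu]_(s in `[0, t]) phi (w s).
Proof.
move=> tT; have /andP[t0 tle] := tT.
have subI : `[0, t] `<=` I.
  by move=> s; rewrite /I/= !in_itv/= => /andP[-> st]; rewrite (le_trans st).
have foo : (mu `[0%R, t]%classic < +oo)%E.
  by apply: le_lt_trans Ioo; apply: le_measure; rewrite ?inE.
have mphi v : strongly_measurable I v -> measurable_fun `[0, t] (fun s => phi (v s)).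
  move=> mv; apply: (@measurable_funS _ _ _ _ I) => //.
  by apply: measurable_continuous_strongly => //; exact: dual_continuous.
have a_meas n : strongly_measurable I (f \o a n).
  exact/strongly_measurable_simple/simple_comp/(approx_simple (approx n)).
have fa_bound n s : `[0, t]%classic s -> `|phi (f (a n s))| <=
    dual_norm phi * (L * (1 + K)).
  move=> /subI/itvP sT; rewrite (le_trans (dual_normP _ _))//.
  rewrite ler_wpM2l ?dual_norm_ge0// (le_trans (f_growth _))// ler_pM2l// lerD2l.
  exact: (approx_bound (approx n)).
have ifa n : mu.-integrable `[0, t] (EFin \o (fun s => phi (f (a n s)))).
  exact: (bounded_integrable _ _ (mphi _ (a_meas n)) (fa_bound n)).
have ix n : mu.-integrable `[0, t] (EFin \o (fun s => phi (x n s))).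
  apply: (@bounded_integrable _ _ _ (dual_norm phi * K)) => //; first exact: mphi.
  move=> s /subI sI; rewrite (le_trans (dual_normP _ _))//.
  by rewrite ler_wpM2l ?dual_norm_ge0// x_bound.
have [my [My yM]] := y_Linfty.
have iy : mu.-integrable `[0, t] (EFin \o (fun s => phi (y s))).
  apply: (@integrableS _ _ _ mu I) => //.
  apply: (@ess_bounded_integrable _ _ _ (dual_norm phi * My)) => //.
    by apply: measurable_continuous_strongly => //; exact: dual_continuous.
  apply: ae_imply yM => s ys Is; rewrite (le_trans (dual_normP _ _))//.
  by rewrite ler_wpM2l ?dual_norm_ge0// ys.
have fa_cvg s : `[0, t]%classic s -> phi (f (a n s)) @[n --> \oo] --> phi (f (U s)).
  move=> /subI/itvP sT; apply: (continuous_cvg _ (@dual_continuous _ _ phi (f (U s)))).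
  by apply: (continuous_cvg _ (@f_cont (U s))); exact: a_cvg.
have ifU : mu.-integrable `[0, t] (EFin \o (fun s => phi (f (U s)))).
  apply: (@bounded_integrable _ _ _ (dual_norm phi * (L * (1 + (K + 1))))) => //.
    exact: (mphi _ (strongly_measurable_comp f_cont U_meas)).
  move=> s /subI sI; rewrite (le_trans (dual_normP _ _))//.
  rewrite ler_wpM2l ?dual_norm_ge0// (le_trans (f_growth _))// ler_pM2l// lerD2l.
  exact: U_bound.
have cvg1 : \int[mu]_(s in `[0, t]) phi (f (a n s)) @[n --> \oo] -->
    \int[mu]_(s in `[0, t]) phi (f (U s)).
  exact: (bounded_convergence _ _ (fun n => mphi _ (a_meas n)) fa_bound fa_cvg).
pose g s : dual E := (\1_(`[0, t]%classic) s : R) *: phi.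
have gE v : \int[mu]_(s in I) (g s (v s)) = \int[mu]_(s in `[0, t]) phi (v s).
  rewrite -(setIidr subI) Rintegral_mkcondr; apply: eq_Rintegral => s _.
  by rewrite /g dual_scaleE patchE indicE; case: ifP => _; rewrite ?mul1r ?mul0r.
have cvg2 : \int[mu]_(s in `[0, t]) phi (x n s) @[n --> \oo] -->
    \int[mu]_(s in `[0, t]) phi (y s).
  rewrite -gE; under eq_cvg => n do rewrite -gE.
  have g_simple : simple g.
    have s1 : @simple R R^o (fun s => \1_(`[0, t]%classic) s).
      split.
        apply: (@sub_finite_set _ _ [set (0 : R); 1]); last by rewrite finite_setU; split; exact: finite_set1.
        by move=> _ [s _ <-]; rewrite indicE; case: (_ \in _); [right|left].
      move=> v; rewrite -[X in measurable X]setTI.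
      have : measurable_fun setT (\1_(`[0, t]%classic) : R -> R) by exact: measurable_indic.
      by apply => //; exact: measurable_set1.
    exact: (@simple_comp R R^o (dual E) (fun c => c *: phi) _ s1).
  apply: x_weak; split; first exact: strongly_measurable_simple.
  have : mu.-integrable I (EFin \o (fun s => `|g s|)).
    apply: (@bounded_integrable _ _ _ `|phi|) => //.
      exact: (measurable_norm_strongly (strongly_measurable_simple I g_simple)).
    move=> s _; rewrite normr_id normrZ indicE; case: (_ \in _).
      by rewrite normr1 mul1r.
    by rewrite normr0 mul0r.
  move=> /integrableP[_]; apply: le_lt_trans; rewrite le_eqVlt; apply/orP; left.
  by apply/eqP; apply: eq_integral => s _; rewrite /= normr_id.
have cvg3 : phi (a n t - u0) @[n --> \oo] --> phi (U t - U 0).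
  rewrite U_start; apply: (continuous_cvg _ (@dual_continuous _ _ phi (U t - u0))).
  by apply: cvgB; [exact: a_cvg|exact: cvg_cst].
have intE n : \int[mu]_(s in `[0, t]) phi (f (a n s) - x n s) =
    \int[mu]_(s in `[0, t]) phi (f (a n s)) - \int[mu]_(s in `[0, t]) phi (x n s).
  by rewrite -(RintegralB _ (ifa n) (ix n))//; apply: eq_Rintegral => s _; rewrite linearB.
have wE : \int[mu]_(s in `[0, t]) phi (w s) =
    \int[mu]_(s in `[0, t]) phi (f (U s)) - \int[mu]_(s in `[0, t]) phi (y s).
  by rewrite -(RintegralB _ ifU iy)//; apply: eq_Rintegral => s _; rewrite linearB.
have cvg4 : phi (a n t - u0) - \int[mu]_(s in `[0, t]) phi (f (a n s) - x n s)
    @[n --> \oo] --> phi (U t - U 0) - \int[mu]_(s in `[0, t]) phi (w s).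
  rewrite wE; under eq_cvg => n do rewrite intE.
  by apply: cvgB => //; exact: cvgB.
have cvg5 : phi (a n t - u0) - \int[mu]_(s in `[0, t]) phi (f (a n s) - x n s)
    @[n --> \oo] --> (0 : R).
  have z : dual_norm phi * e n @[n --> \oo] --> (0 : R).
    by rewrite -[X in _ --> X](mulr0 (dual_norm phi)); apply: cvgMr.
  apply/cvgrPdist_le => eta eta0; have /cvgrPdist_le/(_ _ eta0) := z.
  apply: filterS => n; rewrite !sub0r !normrN => h.
  rewrite (le_trans (approx_integral (approx n) phi tT))// (le_trans _ h)//.
  exact: ler_norm.
by apply/eqP; rewrite -subr_eq0; apply/eqP; exact: (cvg_unique _ cvg4 cvg5).
Qed.

(** Outside one null set the inequality of [weak_limit_proximal] holds for all
    centres [d j]; letting [d j] tend to a point of [C t] gives the proximal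
    inequality there. *)
Lemma limit_normal : {ae mu, forall t, 0 <= t <= T -> normal_cone (C t) (U t) (y t)}.
Proof.
(* The centres [d j] replace the points of [C t]; [delta j t] is the distance that
   this costs. *)
have [d dd] := separable_sequence sepE.
pose rho := r / K; have rho0 : 0 < rho by rewrite divr_gt0.
have p1 : 1 <= p by rewrite (le_trans _ p2)// ler1n.
have /choice[P PP] : forall q : nat * R, exists z, Defs.proj (C q.2) (d q.1) z.
  by move=> [j t]; have [h1 h2 _] := HC t; exact: proj_nonempty.
pose delta j t := `|d j - P (j, t)|.
have PC j t : C t (P (j, t)) by have [] := (projP _ _ _).1 (PP (j, t)).
have Pmin j t c : C t c -> delta j t <= `|d j - c|.
  by have [_] := (projP _ _ _).1 (PP (j, t)); apply.
pose eps n : R := n.+1%:R^-1 + e n.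
pose Kp := p * (rho * K) `^ (p - 1).
have ae_j : {ae mu, forall t, forall j, I t ->
    `|rho *: y t| `^ p - Kp * delta j t <= `|(U t - d j) + rho *: y t| `^ p}.
  apply/ae_foralln => j; pose N := K + 1 + `|d j|.
  apply: (@weak_limit_proximal R E p us p2 I _ Ioo x y (fun t => U t - d j)
    (delta j) eps K N rho rho0) => //.
  - by apply: strongly_measurable_add => //; exact: strongly_measurable_cst.
  - have h := @measurable_distance R E C k (d j) (fun t => P (j, t)) C_lip (fun t => PP (j, t)).
    exact: (measurable_funS (@measurableT _ _) (@subsetT _ I) h).
  - by move=> t It; rewrite (le_trans (ler_normB _ _))// lerD2r U_bound.
  - move=> t It; rewrite normr_ge0/= (le_trans (Pmin _ _ _ (CU (itvP It))))//.
    by rewrite distrC (le_trans (ler_normB _ _))// lerD2r U_bound.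
  - by move=> n; rewrite addr_ge0.
  - by rewrite -[X in _ --> X](addr0 (0 : R)); exact: cvgD.
  - move=> n t It; have tT := itvP It.
    have h1 := approx_proximal (approx n) tT (PC j t).
    rewrite -/rho in h1.
    have h2 := aU n tT.
    have -> : U t - d j + rho *: x n t = (a n t - P (j, t) + rho *: x n t) -
        ((a n t - U t) + (d j - P (j, t))).
      by rewrite opprD !opprB [RHS]addrAC [X in _ = X + _]addrCA !subrKA.
    have h3 := lerB_dist (a n t - P (j, t) + rho *: x n t)
        ((a n t - U t) + (d j - P (j, t))).
    have h4 := ler_normD (a n t - U t) (d j - P (j, t)).
    rewrite distrC in h2.
    by rewrite /eps /delta; move: (n.+1%:R^-1) h2 => q h2; lra.
apply: ae_imply ae_j => t ht tT.
have It : I t by rewrite /I/= in_itv.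
have {}ht j := ht j It.
have CUt := CU tT.
apply: (proximal_normal rho0 CUt) => c Cc.
set Q := `|U t - c + rho *: y t|.
rewrite leNgt; apply/negP => QY.
have : Q `^ p < `|rho *: y t| `^ p.
  by apply: gt0_ltr_powR; rewrite ?nnegrE ?normr_ge0// (lt_le_trans _ p1).
apply/negP; rewrite -leNgt.
have Kp0 : 0 <= Kp by rewrite mulr_ge0 ?powR_ge0// (le_trans _ p1).
(* A Lipschitz constant of the power on [[0, Q + 1]], to return from [d j] to [c]. *)
pose Kq := p * (Q + 1) `^ (p - 1).
have Kq0 : 0 <= Kq by rewrite mulr_ge0 ?powR_ge0// (le_trans _ p1).
apply/ler_addgt0Pr => eta eta0.
have KK : 0 < Kp + Kq + 1 by rewrite ltr_wpDl// addr_ge0.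
pose eta' := Num.min 1 (eta / (Kp + Kq + 1)).
have eta'0 : 0 < eta' by rewrite lt_min ltr01 divr_gt0.
have [j cj] := dd c _ eta'0.
move: (cj); rewrite lt_min => /andP[cj1 cj2]; rewrite ltr_pdivlMr// in cj2.
have dj := Pmin j t c Cc; rewrite distrC in dj.
set Qj := `|U t - d j + rho *: y t|.
have QjQ : `|Qj - Q| <= `|c - d j|.
  rewrite (le_trans (ler_dist_dist _ _))// opprD addrACA subrr addr0.
  by rewrite opprB addrC subrKA.
have Qj1 : Qj <= Q + 1.
  have := ler_norm (Qj - Q); have := ltW cj1; move: QjQ; lra.
have h := powR_sub_le p1 (normr_ge0 _ : 0 <= Q) (normr_ge0 _ : 0 <= Qj) Qj1.
have htj := ht j; rewrite -/Qj in htj.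
have b1 : Kq * `|Qj - Q| <= Kq * `|c - d j| by rewrite ler_wpM2l.
have b2 : Kp * delta j t <= Kp * `|c - d j| by rewrite ler_wpM2l.
rewrite -/Kq in h.
have nn := normr_ge0 (c - d j).
lra.
Qed.

Lemma limit_derivative :
  {ae mu, forall t, t \in `[0, T] -> derivable U t 1 /\ derive1 U t = w t}.
Proof. exact: (ae_derivable us sepE w_meas w_int limit_integral). Qed.

End Limit.

Lemma sweeping_process_solution : exists u : R -> E,
    [/\ abs_continuous 0 T u,
        {ae mu, forall t, t \in `[0, T] ->
           derivable u t 1 /\ normal_cone (C t) (u t) (f (u t) - derive1 u t)},
        u 0 = u0 &
        forall t, t \in `[0, T] -> C t (u t)].
Proof.
have [K K0 /choice[a /choice[x approx]]] :=
  catching_up_approximations T0 r0 k0 L0 f_growth HC C_lip Cu0.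
pose e n := 2 * K * (T / n.+1%:R).
have e_ge0 n : 0 <= e n by rewrite mulr_ge0 ?divr_ge0 ?ltW ?mulr_gt0.
have e_cvg : e n @[n --> \oo] --> (0 : R).
  have h : (2 * K * T) * n.+1%:R^-1 @[n --> \oo] --> (0 : R).
    rewrite -[X in _ --> X](mulr0 (2 * K * T)); apply: cvgMr; exact: cvg_harmonic.
  by under eq_cvg do rewrite /e mulrA.
have cC t : ball_compact (C t) by have [] := HC t.
have [U [s [CU U_lip U_start s_homo aU]]] :=
  uniform_subsequence T0 K0 cC e_ge0 e_cvg approx.
have [||s' [s'_homo [y [y_Linfty [x_weak x_smooth]]]]] := swc (x := fun n => x (s n)).
- by move=> n; exact/strongly_measurable_simple/(approx_normal_simple (approx (s n))).
- exists K => n; apply: aeW => t; rewrite /= in_itv => tT.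
  exact: (approx_normal_bound (approx (s n))).
have homo_ge (v : nat -> nat) : {homo v : m n / (m < n)%N} -> forall n, (n <= v n)%N.
  by move=> hv; elim=> // n IH; exact: leq_ltn_trans IH (hv _ _ (ltnSn n)).
pose tau n := s (s' n).
have e'_cvg : e (tau n) @[n --> \oo] --> (0 : R).
  apply/cvgrPdist_le => eta eta0; have /cvgrPdist_le/(_ _ eta0)[N _ Ne] := e_cvg.
  exists N => // n /= Nn; apply: Ne => /=.
  by rewrite (leq_trans Nn)// (leq_trans (homo_ge _ s'_homo n))// homo_ge.
have aU' n t : 0 <= t <= T -> `|U t - a (tau n) t| <= n.+1%:R^-1.
  move=> tT; rewrite (le_trans (aU _ _ tT))// lef_pV2 ?posrE// ler_nat ltnS.
  exact: homo_ge.
have approx' n := approx (tau n).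
have ae_normal := limit_normal K0 (fun n => e_ge0 (tau n)) e'_cvg approx' aU' CU
  y_Linfty x_smooth.
have ae_der := limit_derivative e'_cvg approx' aU' U_start y_Linfty x_weak.
exists U; split => //.
- exact: lipschitz_abs_continuous U_lip.
- have := negligibleU ae_normal ae_der; apply: negligibleS => t /=.
  move=> /not_implyP[tT nd]; apply: contrapT => /not_orP[/contrapT hn /contrapT hd].
  apply: nd; have [d1 d2] := hd tT.
  split => //; rewrite d2 opprB addrCA subrr addr0.
  by apply: hn; move: tT; rewrite in_itv.
Qed.

End Solution.

(** * Existence of solutions *)

Section Clamp.
Context {R : realType}.
Variable T : R.

(** Freezing the moving set outside the time interval makes the assumptions
   hold at all times, so that the last step of a discretization may overshoot. *)
Definition clamp (t : R) : R := Num.min (Num.max t 0) T.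

Lemma clamp_in t : 0 <= T -> clamp t \in `[0, T].
Proof.
by move=> T0; rewrite in_itv/= /clamp le_min ge_min le_max lexx T0 lexx !orbT.
Qed.

Lemma clamp_id t : t \in `[0, T] -> clamp t = t.
Proof.
by rewrite in_itv/= /clamp => /andP[t0 tT]; rewrite (max_idPl t0) (min_idPl tT).
Qed.

Lemma clamp_lipschitz s t : `|clamp t - clamp s| <= `|t - s|.
Proof.
wlog st : s t / s <= t => [h|].
  have [/h//|/ltW/h] := leP s t; by rewrite distrC (distrC s).
have cst : clamp s <= clamp t by rewrite /clamp le_min2// le_max2.
rewrite !ger0_norm ?subr_ge0//.
rewrite /clamp /Num.min /Num.max; do 4 case: ifP; lra.
Qed.

End Clamp.

Theorem theorem6p11 (R : realType) (B : completeNormedModType R) (T p r : R)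
    (f : B -> B) (C : R -> set B) (u0 : B) :
  0 <= T ->
  separable B -> reflexive_space B -> uniformly_smooth B ->
  2 <= p -> smoothly_weakly_compact `[0, T]%classic B p ->
  continuous f ->
  (exists2 L : R, 0 < L & forall x : B, `|f x| <= L * (1 + `|x|)) ->
  0 < r ->
  (forall t, t \in `[0, T] ->
     [/\ C t !=set0, ball_compact (C t) & prox_regular r (C t)]) ->
  (exists2 k : R, 0 < k & forall s t, s \in `[0, T] -> t \in `[0, T] ->
     (hausdorff_dist (C t) (C s) <= (k * `|t - s|)%:E)%E) ->
  C 0 u0 ->
  exists u : R -> B,
    [/\ abs_continuous 0 T u,
        {ae @lebesgue_measure R, forall t, t \in `[0, T] ->
           derivable u t 1 /\ normal_cone (C t) (u t) (f (u t) - derive1 u t)},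
        u 0 = u0 &
        forall t, t \in `[0, T] -> C t (u t)].
Proof.
move=> T0 sepB _ us p2 swc f_cont [L L0 f_growth] r0 HC [k k0 C_haus] Cu0.
have [T00|Tn0] := eqVneq T 0.
  (* On a degenerate interval the constant curve will do. *)
  rewrite {}T00 in HC C_haus *.
  have t0 (t : R) : t \in `[0, 0] -> t = 0.
    by rewrite in_itv/= => /andP[a b]; apply/le_anti/andP.
  exists (cst u0); split => //; last by move=> t /t0 ->.
    move=> e e0; exists 1 => // n s t st _ _; rewrite big1// => i _.
    by rewrite subrr normr0.
  have n0 : (@lebesgue_measure R).-negligible [set (0 : R)].
    by apply/negligibleP => //; exact: lebesgue_measure_set1.
  by apply: negligibleS n0 => t /= /not_implyP[/t0].
have {Tn0}T0' : 0 < T by rewrite lt_neqAle eq_sym Tn0.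
pose C' t := C (clamp T t).
have cT t : clamp T t \in `[0, T] by exact: clamp_in.
have HC' t : [/\ C' t !=set0, ball_compact (C' t) & prox_regular r (C' t)].
  exact: HC.
have C'_lip s t x : C' s x -> exists2 y, C' t y & `|x - y| <= k * `|t - s|.
  move=> Csx; have [C0 Cc _] := HC' t.
  have [y Cy xy] := hausdorff_dist_near C0 Cc (C_haus _ _ (cT s) (cT t)) Csx.
  by exists y => //; rewrite (le_trans xy)// ler_pM2l// clamp_lipschitz.
have C'E t : t \in `[0, T] -> C' t = C t by move=> tT; rewrite /C' clamp_id.
have C'u0 : C' 0 u0 by rewrite C'E// in_itv/= lexx.
have [u [u_ac u_ae u_start uC]] := sweeping_process_solution T0' r0 k0 L0 p2 sepB us
  swc f_cont f_growth HC' C'_lip C'u0.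
exists u; split => //; last by move=> t tT; rewrite -C'E//; exact: uC.
by apply: ae_imply u_ae => t h tT; rewrite -C'E//; exact: h.
Qed.
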